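(* For all $n\geq2$ and $1\leq k<d$, there exists a constant $\delta_{n,d,k}>0$, depending only on $n$, $d$ and $k$, such that for any harmonic polynomial $p:\mathbb{R}^n\to\mathbb{R}$ of degree $d$ and any $x\in\Sigma_p$, $$\partial^\alpha p(x)=0\ \text{ for all }|\alpha|\leq k\quad\Longleftrightarrow\quad\Theta_{\Sigma_p}^{\mathcal{H}_{n,k}}(x,r)\geq\delta_{n,d,k}\ \text{ for all }r>0,$$ $$\partial^\alpha p(x)\neq0\ \text{ for some }|\alpha|\leq k\quad\Longleftrightarrow\quad\Theta_{\Sigma_p}^{\mathcal{H}_{n,k}}(x,r)<\delta_{n,d,k}\ \text{ for some }r>0.$$ Moreover, there exists a constant $C_{n,d,k}>1$ depending only on $n$, $d$ and $k$ such that (for all such $p$ and $x$), for every $r>0$, $$\Theta_{\Sigma_p}^{\mathcal{H}_{n,k}}(x,r)<\delta_{n,d,k}\ \Longrightarrow\ \Theta_{\Sigma_p}^{\mathcal{H}_{n,k}}(x,sr)<C_{n,d,k}\,s^{1/k}\ \text{ for all }s\in(0,1).$$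
   Context: For a polynomial $p:\mathbb{R}^n\to\mathbb{R}$, $\Sigma_p=\{x:p(x)=0\}$. $\mathcal{H}_{n,k}$ is the collection of all zero sets $\Sigma_q$ of nonconstant harmonic polynomials $q:\mathbb{R}^n\to\mathbb{R}$ of degree at most $k$ with $q(0)=0$. $B(x,r)$ is the open ball. For a nonempty set $A\subseteq\mathbb{R}^n$, $x\in A$, $r>0$, $$\Theta^{\mathcal{H}_{n,k}}_A(x,r)=\frac1r\inf_{S\in\mathcal{H}_{n,k}}\max\Big\{\sup_{a\in A\cap B(x,r)}\operatorname{dist}(a,x+S),\ \sup_{z\in(x+S)\cap B(x,r)}\operatorname{dist}(z,A)\Big\}.$$ $\alpha$ denotes a multi-index and $\partial^\alpha$ the corresponding partial derivative. *)

(* Defs.v *)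
(* A file that also imports all_analysis must import mpoly before it: in the
   other order their notations clash. *)
From mathcomp Require Import all_boot all_order all_algebra.
From mathcomp Require Import mpoly.
From mathcomp Require Import classical_sets reals.

Set Implicit Arguments.
Unset Strict Implicit.
Unset Printing Implicit Defensive.

Import Order.TTheory GRing.Theory Num.Theory.

Local Open Scope classical_set_scope.
Local Open Scope ring_scope.

(* The library's norm on 'rV[R]_n is the sup norm, hence this one. *)
Definition enorm (R : realType) (n : nat) (v : 'rV[R]_n) : R :=
  Num.sqrt (\sum_i v 0 i ^+ 2).

Definition eball (R : realType) (n : nat) (x : 'rV[R]_n) (r : R) :
    set 'rV[R]_n :=
  [set y | enorm (y - x) < r].

Definition dist_set (R : realType) (n : nat) (x : 'rV[R]_n)
    (A : set 'rV[R]_n) : R :=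
  inf [set enorm (x - a) | a in A].

Definition zero_set (R : realType) (n : nat) (p : {mpoly R[n]}) :
    set 'rV[R]_n :=
  [set x | p.@[x 0] = 0].

Definition harmonic (R : realType) (n : nat) (p : {mpoly R[n]}) : Prop :=
  \sum_(i < n) (p^`M(i))^`M(i) = 0.

(* msize is one plus the degree, so 1 < msize q says that q is nonconstant. *)
Definition harmonic_zero_sets (R : realType) (n k : nat) :
    set (set 'rV[R]_n) :=
  [set S | exists q : {mpoly R[n]},
    [/\ harmonic q, (1 < msize q)%N, (msize q <= k.+1)%N,
        q.@[(0 : 'rV[R]_n) 0] = 0 & S = zero_set q]].

Definition translate (R : realType) (n : nat) (x : 'rV[R]_n)
    (S : set 'rV[R]_n) : set 'rV[R]_n :=
  [set x + s | s in S].

(* sup and inf are the real-valued ones, with value 0 on sets having no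
   supremum or infimum. When x \in A, 0 < n, 0 < k and 0 < r this default plays
   no role: every S contains 0, so both suprema are over nonempty sets of
   reals in [0, r]. *)
Definition Theta (R : realType) (n k : nat) (A : set 'rV[R]_n)
    (x : 'rV[R]_n) (r : R) : R :=
  r^-1 * inf [set Num.max
                    (sup [set dist_set a (translate x S)
                         | a in A `&` eball x r])
                    (sup [set dist_set z A
                         | z in translate x S `&` eball x r])
             | S in @harmonic_zero_sets R n k].

(* Main.v *)
(** Rescaling x + r . to the unit ball, everything is about the finite-dimensional
space of harmonic polynomials of degree at most d, on which compactness gives
uniform constants.

The lower bound for Theta. By compactness and sign changes (a nonzero harmonic
polynomial changes sign near each of its zeros), a failure produces nonzero
harmonic polynomials P, vanishing to order > k at 0, and Q, of degree <= k,
with Q = 0 on the zeros of P in the unit ball; blowing up at 0 makes them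
homogeneous, of degrees m > i. This is impossible: |p| and |q| are
eigenfunctions of the spherical Laplacian, with different eigenvalues, up to a
singular term of Lap |p| carried by the zeros of p, where |q| vanishes. Hence
(lambda_m - lambda_i) E[|p q|] <= 0 for the mean E over the sphere. To stay
within polynomials, |s| is replaced by polynomials with second derivative
c (1 - s^2)^N, and E is the algebraic functional on polynomials given by the
moments; its positivity comes from the one-dimensional Gaussian moments, since
a nonnegative polynomial in one variable is a sum of squares.

The upper bound for Theta. If the part Q of degree <= k of P has norm >= c, then
after rescaling by s both P and Q are O(s^(k+1)) on the zeros of either, while
the norm of Q is >= c s^k. If the other polynomial has no zero in a ball of
radius rho around such a point, it has constant sign there, and Harnack's
inequality makes it O(s^(k+1)) on that ball, while a polynomial of degree <= k
and norm >= c s^k cannot be smaller than rho^k s^k there, up to a constant.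
Thus rho^k = O(s). *)
Require Import Defs.
From HB Require Import structures.
From mathcomp Require Import all_boot all_order all_algebra.
From mathcomp Require Import ssrcomplements mpoly.
From mathcomp Require Import ring lra zify.
From mathcomp Require Import polyrcf.
From mathcomp Require Import boolp classical_sets reals topology normedtype derive exp.

Set Implicit Arguments.
Unset Strict Implicit.
Unset Printing Implicit Defensive.

Import Order.TTheory GRing.Theory Num.Theory numFieldNormedType.Exports.
Local Open Scope ring_scope.

(** * Gaussian moments in one variable *)

Section Gauss1.
Variable R : realType.
Implicit Types f g h : {poly R}.

(** The moments 1, 0, 1, 0, 3, ... of the standard normal law, through the recursion that
    integration by parts gives. No measure enters: means are linear functionals on polynomials. *)
Fixpoint gauss_moment (a : nat) : R :=
  match a with
  | 0 => 1
  | 1 => 0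
  | (b.+1 as c).+1 => c%:R * gauss_moment b
  end.

Definition gauss1 f : R := \sum_(i < size f) f`_i * gauss_moment i.

Lemma gauss1w N f : (size f <= N)%N ->
  gauss1 f = \sum_(i < N) f`_i * gauss_moment i.
Proof.
move=> fN; rewrite /gauss1 (big_ord_widen _ (fun i => f`_i * gauss_moment i) fN).
rewrite big_mkcond; apply: eq_bigr => i _; case: ltnP => // le.
by rewrite nth_default ?mul0r.
Qed.

Lemma gauss1_is_linear : linear_for *%R gauss1.
Proof.
move=> a f g; pose N := maxn (size f) (size g).
rewrite (@gauss1w N (a *: f + g)); last first.
  apply: (leq_trans (size_polyD _ _)); rewrite geq_max leq_maxr andbT.
  by apply: (leq_trans (size_scale_leq _ _)); exact: leq_maxl.
rewrite (@gauss1w N f) ?leq_maxl // (@gauss1w N g) ?leq_maxr //.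
rewrite mulr_sumr -big_split /=; apply: eq_bigr => i _.
by rewrite coefD coefZ mulrDl mulrA.
Qed.

HB.instance Definition _ :=
  GRing.isLinear.Build R {poly R} R *%R gauss1 gauss1_is_linear.

Lemma gauss1D f g : gauss1 (f + g) = gauss1 f + gauss1 g.
Proof. exact: raddfD. Qed.

Lemma gauss1Mn f k : gauss1 (f *+ k) = gauss1 f *+ k.
Proof. exact: raddfMn. Qed.

Lemma gauss1Z c f : gauss1 (c *: f) = c * gauss1 f.
Proof. exact: linearZ. Qed.

Lemma gauss10 : gauss1 0 = 0.
Proof. exact: raddf0. Qed.

Lemma gauss1C c : gauss1 c%:P = c.
Proof.
rewrite (@gauss1w 1) ?size_polyC ?leq_b1 // big_ord1 coefC /= mulr1 //.
Qed.

(** Gaussian integration by parts; on monomials it is the recursion for the moments. *)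
Lemma gauss1_mulX f : gauss1 (f * 'X) = gauss1 f^`().
Proof.
rewrite (@gauss1w (size f).+2); last first.
  by apply: leq_trans (size_polyMleq _ _) _; rewrite size_polyX addn2.
rewrite (@gauss1w (size f)); last first.
  by have [->|/lt_size_deriv/ltnW//] := eqVneq f 0; rewrite deriv0.
rewrite !big_ord_recl coefMX mul0r add0r /= mulr0 add0r.
apply: eq_bigr => i _; rewrite coefMX coef_deriv /=.
by rewrite /bump leq0n !add0n add1n -mulr_natl; ring.
Qed.

(* Parseval for the expansion in Hermite polynomials, whose [k]-th coefficient
   is [gauss1 f^`(k) / k!]. *)
Definition hermite_form (N : nat) f g : R :=
  \sum_(k < N) gauss1 f^`(k) * gauss1 g^`(k) / k`!%:R.

Lemma gauss1_derivn_mulX f k :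
  gauss1 (f * 'X)^`(k.+1) = gauss1 f^`(k.+2) + gauss1 f^`(k) *+ k.+1.
Proof.
have -> : (f * 'X)^`(k.+1) = f^`(k.+1) * 'X + f^`(k) *+ k.+1.
  elim: k => [|k IH]; first by rewrite !derivn1 derivM derivX mulr1.
  rewrite derivnS IH derivD derivM derivX mulr1 derivMn -!derivnS.
  by rewrite -addrA -mulrS.
by rewrite gauss1D gauss1_mulX gauss1Mn -derivnS.
Qed.

(** In the Hermite basis multiplication by ['X] is the sum of a raising and a lowering operator,
    adjoint to each other for the weights 1/k!. The size bounds kill the boundary term at index
    [N]. *)
Lemma hermite_form_mulX N f g : (size f <= N)%N -> (size g <= N)%N ->
  hermite_form N.+1 (f * 'X) g = hermite_form N.+1 f (g * 'X).
Proof.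
move=> sf sg; rewrite /hermite_form.
pose a k := gauss1 f^`(k); pose b k := gauss1 g^`(k).
have aN : a N = 0 by rewrite /a derivn_poly0 // gauss10.
have bN : b N = 0 by rewrite /b derivn_poly0 // gauss10.
have fact1 (k : nat) : (k.+1`!%:R)^-1 = (k`!%:R)^-1 / k.+1%:R :> R.
  by rewrite factS natrM invfM mulrC.
(* The right-hand side is symmetric in [u] and [v], so applying this to both sides of the goal
   proves it. *)
have key (u v : {poly R}) : gauss1 v^`(N) = 0 ->
    \sum_(k < N.+1) gauss1 (u * 'X)^`(k) * gauss1 v^`(k) / k`!%:R =
    \sum_(k < N) (gauss1 u^`(k.+1) * gauss1 v^`(k)
       + gauss1 u^`(k) * gauss1 v^`(k.+1)) / k`!%:R.
  move=> vN; rewrite big_ord_recl /= gauss1_mulX fact0 divr1.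
  under eq_bigr => i _ do rewrite gauss1_derivn_mulX.
  under [RHS]eq_bigr => i _ do rewrite mulrDl.
  rewrite [RHS]big_split /=.
  have -> : \sum_(i < N) gauss1 u^`(i.+1) * gauss1 v^`(i) / i`!%:R =
     gauss1 u^`() * gauss1 v
     + \sum_(i < N) gauss1 u^`(i.+2) * gauss1 v^`(i.+1) / i.+1`!%:R.
    transitivity (\sum_(i < N.+1) gauss1 u^`(i.+1) * gauss1 v^`(i) / i`!%:R).
      by rewrite big_ord_recr /= vN mulr0 mul0r addr0.
    by rewrite big_ord_recl /= fact0 divr1.
  rewrite -addrA; congr (_ + _); rewrite -big_split /=.
  apply: eq_bigr => i _; rewrite /= fact1 -mulr_natl; field.
  by rewrite -(natrD _ 1) !pnatr_eq0 -lt0n fact_gt0.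
rewrite key //.
under [RHS]eq_bigr => i _ do rewrite (mulrC (gauss1 _)).
by rewrite key //; apply: eq_bigr => i _; rewrite addrC mulrC; ring.
Qed.

(** Induction on [f]: a factor ['X] is moved from [f] to [g] by symmetry, until [f] is constant and
    only the term of index 0 is left. *)
Lemma hermite_formE N f g : (size f + size g <= N)%N ->
  hermite_form N.+1 f g = gauss1 (f * g).
Proof.
elim/poly_ind: f g => [|f c IH] g sfg.
  rewrite mul0r gauss10 /hermite_form big1 // => i _.
  by rewrite linear0 gauss10 !mul0r.
have hc : hermite_form N.+1 c%:P g = c * gauss1 g.
  rewrite /hermite_form big_ord_recl big1 => [|i _].
    by rewrite /= gauss1C fact0 divr1 addr0.
  rewrite (@derivn_poly0 _ c%:P) ?gauss10 ?mul0r //.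
  by apply: leq_trans (size_polyC_leq1 c) _.
have -> : hermite_form N.+1 (f * 'X + c%:P) g =
    hermite_form N.+1 (f * 'X) g + hermite_form N.+1 c%:P g.
  rewrite /hermite_form -big_split; apply: eq_bigr => i _ /=.
  by rewrite derivnD gauss1D !mulrDl.
rewrite hc mulrDl gauss1D mul_polyC gauss1Z; congr (_ + _).
have [->|f0] := eqVneq f 0.
  rewrite !mul0r gauss10 /hermite_form big1 // => i _.
  by rewrite linear0 gauss10 !mul0r.
have sfX : (size (f * 'X + c%:P)) = (size f).+1.
  by rewrite size_MXaddC (negPf f0).
rewrite sfX in sfg.
rewrite hermite_form_mulX; [|lia|lia].
have [->|g0] := eqVneq g 0.
  by rewrite mul0r mulr0 gauss10 /hermite_form big1 // => i _; rewrite linear0 gauss10 mulr0 mul0r.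
rewrite IH; first by congr (gauss1 _); ring.
by rewrite size_mulX // addnS.
Qed.

(** By Parseval this is a sum of squares; the term whose index is the degree of [h] is nonzero, as
    that derivative is a nonzero constant. *)
Lemma gauss1_sqr_gt0 h : h != 0 -> 0 < gauss1 (h * h).
Proof.
move=> h0; rewrite -(@hermite_formE (size h + size h)) // /hermite_form.
have s0 : (size h > 0)%N by rewrite size_poly_gt0.
have lt : ((size h).-1 < (size h + size h).+1)%N by lia.
rewrite (bigD1 (Ordinal lt)) //= ltr_wpDr //.
  apply: sumr_ge0 => i _; rewrite -expr2 divr_ge0 ?sqr_ge0 // ler0n.
rewrite divr_gt0 ?ltr0n ?fact_gt0 // -expr2 exprn_even_gt0 //=.
have -> : h^`((size h).-1) = (lead_coef h *+ (size h).-1`!)%:P.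
  apply/polyP => i; rewrite coef_derivn coefC; case: eqP => [->|/eqP i0].
    by rewrite addn0 ffactnn lead_coefE.
  by rewrite nth_default ?mul0rn // -(prednK s0) prednK //; lia.
by rewrite gauss1C mulrn_eq0 lead_coef_eq0 negb_or h0 -lt0n fact_gt0.
Qed.

(** * Nonnegative polynomials in one variable *)

Lemma poly_ge0_lead_coef f :
  (forall x, 0 <= f.[x]) -> f != 0 -> 0 < lead_coef f.
Proof.
move=> f0 fn0; have ln0 : lead_coef f != 0 by rewrite lead_coef_eq0.
rewrite lt_def ln0 leNgt; apply/negP => lc0.
have [M MP] : exists M, forall x, M <= x -> lead_coef (- f) <= (- f).[x].
  by apply: poly_pinfty_gt_lc; rewrite lead_coefN oppr_gt0.
have := MP M (lexx _); rewrite lead_coefN hornerN lerN2 => /(le_trans (f0 M)).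
by rewrite leNgt lc0.
Qed.

Lemma poly_ge0_above f : (forall x, 0 <= f.[x]) ->
  exists M, forall x, M <= x -> f.[0] <= f.[x].
Proof.
move=> f0; have [s1|s1] := leqP (size f) 1.
  by exists 0 => x _; rewrite (size1_polyC s1) !hornerC.
have fn0 : f != 0 by rewrite -size_poly_gt0; exact: ltn_trans s1.
have lc : lead_coef (f - f.[0]%:P) = lead_coef f.
  by rewrite lead_coefDl // size_polyN (leq_ltn_trans (size_polyC_leq1 _)).
have [M MP] : exists M, forall x, M <= x ->
    lead_coef (f - f.[0]%:P) <= (f - f.[0]%:P).[x].
  by apply: poly_pinfty_gt_lc; rewrite lc; exact: poly_ge0_lead_coef.
exists M => x /MP; rewrite lc hornerD hornerN hornerC -subr_ge0 => le.
by rewrite -subr_ge0 in le *; have := poly_ge0_lead_coef f0 fn0; lra.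
Qed.

(** Outside a large interval the values are at least [f.[0]], so a minimum over the interval is a
    global one. *)
Lemma poly_ge0_min f : (forall x, 0 <= f.[x]) ->
  exists a, forall x, f.[a] <= f.[x].
Proof.
move=> f0; have [M MP] := poly_ge0_above f0.
have [M' MP'] : exists M, forall x, M <= x -> f.[0] <= f.[- x].
  have [|M' MP'] := @poly_ge0_above (f \Po (- 'X)).
    by move=> x; rewrite horner_comp.
  exists M' => x /MP'; by rewrite !horner_comp !hornerE oppr0.
pose K := Num.max 0 (Num.max M M').
have [K0 KM KM'] : [/\ 0 <= K, M <= K & M' <= K].
  by rewrite /K !le_max !lexx /= !orbT.
have [a aK amin] : exists2 a, a \in `[- K, K]%R &
    forall t, t \in `[- K, K]%R -> f.[a] <= f.[t].
  apply: EVT_min; first by lra.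
  by apply: continuous_subspaceT => x; exact: continuous_horner.
exists a => x; have [xK|xK] := boolP (x \in `[- K, K]%R); first exact: amin.
have a0 : f.[a] <= f.[0] by apply: amin; rewrite in_itv /=; lra.
apply: le_trans a0 _; move: xK; rewrite in_itv /= negb_and -!ltNge => /orP[xK|xK].
  by rewrite -(opprK x); apply: MP'; lra.
by apply: MP; lra.
Qed.

Lemma horner_ge0_lim f a s : `|s| <= 1 ->
  (forall e, 0 < e -> 0 <= f.[a + s * e]) -> 0 <= f.[a].
Proof.
move=> s1 fe; rewrite leNgt; apply/negP => fa.
have [|d d0 dP] := @poly_cont _ a f (- f.[a]); first by rewrite oppr_gt0.
have := dP (a + s * (d / 2)); rewrite addrC addKr normrM.
rewrite (gtr0_norm (_ : 0 < d / 2)) ?divr_gt0 // => /(_ _)/wrap[].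
  by apply: le_lt_trans (_ : 1 * (d / 2) < _); [rewrite ler_pM2r ?divr_gt0|lra].
rewrite addrC => /(le_lt_trans (ler_norm _)).
by have := fe (d / 2); rewrite divr_gt0 // => /(_ isT); lra.
Qed.

(* Nonnegative polynomials in one variable are sums of squares: subtract the
   minimum, and divide by the square of [X - a] at a minimum point [a]. *)
Lemma gauss1_sqr_mul_gt0 h f : h != 0 -> f != 0 -> (forall x, 0 <= f.[x]) ->
  0 < gauss1 (h * h * f).
Proof.
have [N] := ubnP (size f); elim: N h f => // N IH h f; rewrite ltnS => sN h0 fn0 f0.
have [s1|s1] := leqP (size f) 1.
  move: fn0 (f0 0); rewrite (size1_polyC s1) hornerC polyC_eq0 => c0 cge0.
  by rewrite mulrC mul_polyC gauss1Z mulr_gt0 ?gauss1_sqr_gt0 // lt_def c0.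
have [a amin] := poly_ge0_min f0.
pose g := f - f.[a]%:P.
have g0 x : 0 <= g.[x] by rewrite /g hornerD hornerN hornerC subr_ge0.
have gn0 : g != 0.
  rewrite subr_eq0; apply/eqP => fE; move: s1.
  by rewrite fE ltnNge size_polyC_leq1.
have ga : root g a by rewrite /root /g hornerD hornerN hornerC subrr.
have [q qE] : exists q, g = q * ('X - a%:P) by apply/factor_theorem.
(* Since [g] is nonnegative, [q] is nonpositive to the left of [a] and nonnegative to the right;
   hence [a] is a double root of [g]. *)
have qa : root q a.
  apply/eqP/le_anti/andP; split.
    rewrite -oppr_ge0 -hornerN; apply: (@horner_ge0_lim _ _ (-1)).
      by rewrite normrN1.
    move=> e e0; have := g0 (a + -1 * e); rewrite qE hornerM hornerXsubC hornerN.
    by rewrite addrAC subrr add0r mulN1r mulrN -mulNr pmulr_lge0.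
  apply: (@horner_ge0_lim _ _ 1); first by rewrite normr1.
  move=> e e0; have := g0 (a + 1 * e); rewrite qE hornerM hornerXsubC.
  by rewrite addrAC subrr add0r mul1r pmulr_lge0.
have [r rE] : exists r, q = r * ('X - a%:P) by apply/factor_theorem.
have gE : g = ('X - a%:P) * ('X - a%:P) * r by rewrite qE rE; ring.
have rn0 : r != 0 by apply: contraNneq gn0 => r0; rewrite gE r0 mulr0.
have sg : (size g <= size f)%N.
  apply: (leq_trans (size_polyD _ _)); rewrite size_polyN geq_max leqnn /=.
  by apply: leq_trans (size_polyC_leq1 _) (ltnW s1).
have sr : (size r < size g)%N.
  rewrite gE size_mul ?mulf_neq0 ?polyXsubC_eq0 // size_mul ?polyXsubC_eq0 //.
  by rewrite !size_XsubC /=.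
have r0' x : x != a -> 0 <= r.[x].
  move=> xa; have := g0 x; rewrite gE !hornerM hornerXsubC -expr2 pmulr_rge0 //.
  by rewrite exprn_even_gt0 //= subr_eq0.
have r0 x : 0 <= r.[x].
  have [->|/r0'//] := eqVneq x a.
  apply: (@horner_ge0_lim _ _ 1); first by rewrite normr1.
  by move=> e e0; apply: r0'; rewrite mul1r -subr_eq0 addrC addKr gt_eqF.
(* The first summand has nonnegative mean; the induction hypothesis applies to the second, with [r]
   smaller than [f]. *)
have -> : h * h * f = f.[a] *: (h * h) + (h * ('X - a%:P)) * (h * ('X - a%:P)) * r.
  have {1}-> : f = f.[a]%:P + g by rewrite /g; ring.
  by rewrite mulrDr gE -mul_polyC; ring.
rewrite gauss1D gauss1Z ltr_wpDl //.
  by rewrite mulr_ge0 // ltW // gauss1_sqr_gt0.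
apply: IH => //; first by exact: leq_trans sr (leq_trans sg sN).
by rewrite mulf_neq0 // polyXsubC_eq0.
Qed.

Lemma poly_horner0 g : (forall t, g.[t] = 0) -> g = 0.
Proof.
move=> g0; apply/eqP; apply/negPn/negP => gn0.
have h1 : 0 < lead_coef g by apply: poly_ge0_lead_coef => // t; rewrite g0.
have : 0 < lead_coef (- g).
  by apply: poly_ge0_lead_coef; rewrite ?oppr_eq0 // => t; rewrite hornerN g0 oppr0.
by rewrite lead_coefN; lra.
Qed.

Lemma poly_horner_inj f g : (forall t, f.[t] = g.[t]) -> f = g.
Proof.
move=> fg; apply/eqP; rewrite -subr_eq0; apply/eqP/poly_horner0 => t.
by rewrite hornerD hornerN fg subrr.
Qed.

End Gauss1.

(** * Gaussian moments in several variables *)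

Section MLin.
Variables (R : realType) (n : nat).
Implicit Types (p q f g : {mpoly R[n]}) (x y : 'I_n -> R) (w : 'X_{1..n} -> R).

Definition mlin w f : R := \sum_(m <- msupp f) f@_m * w m.

Lemma mlin_is_linear w : linear_for *%R (mlin w).
Proof.
move=> c p q.
pose D := maxn (msize p) (msize q).
have mlinD f : (msize f <= D)%N ->
    mlin w f = \sum_(m : 'X_{1..n < D}) f@_m * w m.
  move=> le_D; pose I : subFinType _ := 'X_{1..n < D}.
  rewrite /mlin (big_mksub I) ?msupp_uniq //=; last first.
    by move=> m /msize_mdeg_lt /leq_trans; apply.
  by rewrite big_rmcond //= => i /memN_msupp_eq0 ->; rewrite mul0r.
rewrite !mlinD ?leq_maxl ?leq_maxr //; last first.
  apply: (leq_trans (msizeD_le _ _)); rewrite geq_max leq_maxr andbT.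
  by apply: (leq_trans (msizeZ_le _ _)); exact: leq_maxl.
rewrite mulr_sumr -big_split /=; apply: eq_bigr => i _.
by rewrite mcoeffD mcoeffZ mulrDl mulrA.
Qed.

HB.instance Definition _ w :=
  GRing.isLinear.Build R {mpoly R[n]} R *%R (mlin w) (mlin_is_linear w).

Lemma mlinD w f g : mlin w (f + g) = mlin w f + mlin w g.
Proof. exact: raddfD. Qed.

Lemma mlinB w f g : mlin w (f - g) = mlin w f - mlin w g.
Proof. exact: raddfB. Qed.

Lemma mlinZ w c f : mlin w (c *: f) = c * mlin w f.
Proof. exact: linearZ. Qed.

Lemma mlin0 w : mlin w 0 = 0.
Proof. exact: raddf0. Qed.

Lemma mlin_sum w (I : Type) (r : seq I) (P : pred I) (F : I -> {mpoly R[n]}) :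
  mlin w (\sum_(i <- r | P i) F i) = \sum_(i <- r | P i) mlin w (F i).
Proof. exact: raddf_sum. Qed.

Lemma mlinX w m : mlin w 'X_[m] = w m.
Proof. by rewrite /mlin msuppX big_seq1 mcoeffX eqxx mul1r. Qed.

Lemma eq_linear_mpoly (F G : {mpoly R[n]} -> R) :
  linear_for *%R F -> linear_for *%R G ->
  (forall m, F 'X_[m] = G 'X_[m]) -> F =1 G.
Proof.
move=> linF linG FG f.
have H0 (H : {mpoly R[n]} -> R) : linear_for *%R H -> H 0 = 0.
  by move=> /(_ 1 0 0); rewrite scaler0 addr0 mul1r => /eqP; rewrite -subr_eq0 opprD addNKr oppr_eq0 => /eqP.
elim/mpolyind: f => [|c m f _ _ IH]; first by rewrite !H0.
by rewrite linF linG IH FG.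
Qed.

(** * Integrating out one variable at a time *)

Definition upd x (k : 'I_n) (t : R) : 'I_n -> R :=
  fun j => if j == k then t else x j.

(* Interpolates between evaluation at [x], for [k = 0], and the functional with
   weights [w], for [k = n]. *)
Definition partial_mom (w : 'I_n -> nat -> R) k f x : R :=
  mlin (fun m => \prod_(j < n) (if (j < k)%N then w j (m j) else x j ^+ m j)) f.

(** [partial_mom w k] with the variable of index [k] left free. Applying the one-variable functional
    with moments [w k] to this polynomial gives [partial_mom w k.+1], as in Fubini's theorem. *)
Definition partial_poly (w : 'I_n -> nat -> R) (k : 'I_n) f x : {poly R} :=
  \sum_(m <- msupp f)
    (f@_m * \prod_(j < n | j != k)
       (if (j < k)%N then w j (m j) else x j ^+ m j)) *: 'X^(m k).

Implicit Types v : 'I_n -> nat -> R.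

Lemma horner_partial_poly v k f x t :
  (partial_poly v k f x).[t] = partial_mom v k f (upd x k t).
Proof.
rewrite /partial_poly /partial_mom /mlin horner_sum; apply: eq_bigr => m _.
rewrite hornerZ hornerXn (bigD1 k (P := xpredT)) //= ltnn /upd eqxx.
rewrite -mulrA [X in _ * X = _]mulrC; congr (_ * (_ * _)).
by apply: eq_bigr => j /negPf ->.
Qed.

Lemma coef_partial_poly v (k : 'I_n) f x (L : {poly R} -> R) :
  (forall c (a b : {poly R}), L (c *: a + b) = c * L a + L b) ->
  (forall i, L 'X^i = v k i) ->
  L (partial_poly v k f x) = partial_mom v k.+1 f x.
Proof.
move=> lin LX.
have L0 : L 0 = 0.
  by have := lin 1 0 0; rewrite scaler0 addr0 mul1r => /eqP; rewrite -subr_eq0 opprD addNKr oppr_eq0 => /eqP.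
rewrite /partial_poly /partial_mom /mlin.
elim: (msupp f) => [|m s IH]; first by rewrite !big_nil.
rewrite !big_cons lin IH LX; congr (_ + _).
rewrite (bigD1 k (P := xpredT)) //= ltnSn -mulrA [X in _ * X = _]mulrC; congr (_ * (_ * _)).
apply: eq_bigr => j jk.
by rewrite ltnS [in RHS]leq_eqVlt (negPf (jk : val j != val k)).
Qed.

Lemma partial_mom0 v f x : partial_mom v 0 f x = f.@[x].
Proof. by rewrite /partial_mom /mlin mevalE. Qed.

Lemma partial_momn v f x :
  partial_mom v n f x = mlin (fun m => \prod_(j < n) v j (m j)) f.
Proof.
rewrite /partial_mom /mlin; apply: eq_bigr => m _; congr (_ * _).
by apply: eq_bigr => j _; rewrite ltn_ord.
Qed.

Lemma upd_id x k : upd x k (x k) =1 x.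
Proof. by move=> j; rewrite /upd; case: eqP => [->|]. Qed.

Lemma eq_partial_mom v k f x y : x =1 y -> partial_mom v k f x = partial_mom v k f y.
Proof.
move=> xy; rewrite /partial_mom /mlin; apply: eq_bigr => m _; congr (_ * _).
by apply: eq_bigr => j _; rewrite xy.
Qed.

(** The weights [v] make the full functional extract the coefficient at [a]. It is reached one
    variable at a time, and each stage preserves vanishing, by the one-variable case. *)
Lemma mpoly_meval0 f : (forall x, f.@[x] = 0) -> f = 0.
Proof.
move=> f0; apply/mpolyP => a; rewrite mcoeff0.
pose v (j : 'I_n) (i : nat) : R := (i == a j)%:R.
have wn k x : (k <= n)%N -> partial_mom v k f x = 0.
  elim: k x => [|k IH] x kn; first by rewrite partial_mom0.
  pose K := Ordinal kn.
  rewrite -(@coef_partial_poly v K f x (fun g : {poly R} => g`_(a K))).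
  - rewrite (@poly_horner0 _ (partial_poly _ _ _ _)) ?coef0 // => t.
    by rewrite horner_partial_poly IH // ltnW.
  - by move=> c p q; rewrite coefD coefZ.
  - by move=> i; rewrite coefXn eq_sym.
have := wn n (fun=> 0) (leqnn n); rewrite partial_momn => <-.
rewrite {1}(mpolyE f) raddf_sum /mlin /=; apply: eq_bigr => m _.
rewrite mcoeffZ mcoeffX; congr (_ * _).
have [->|ma] := eqVneq m a; first by rewrite big1 // => j _; rewrite /v eqxx.
have /existsP[j jP] : [exists j, m j != a j].
  rewrite -negb_forall; apply: contra ma => /forallP h.
  by apply/eqP/mnmP => j; apply/eqP.
by rewrite (bigD1 j) //= /v (negPf jP) mul0r.
Qed.

Definition gaussE f : R := mlin (fun m => \prod_(j < n) gauss_moment R (m j)) f.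

Lemma gauss1Xn i : gauss1 'X^i = gauss_moment R i.
Proof.
rewrite /gauss1 size_polyXn big_ord_recr /= coefXn eqxx mul1r big1 ?add0r //.
by move=> j _; rewrite coefXn ltn_eqF ?mul0r.
Qed.

(** Each one-variable mean preserves nonnegativity and the existence of a point with positive value,
    by [gauss1_sqr_mul_gt0] with [h] equal to 1. *)
Lemma gaussE_gt0 f x0 :
  (forall x, 0 <= f.@[x]) -> 0 < f.@[x0] -> 0 < gaussE f.
Proof.
move=> f0 fx0; pose w := fun _ : 'I_n => gauss_moment R.
have wn k : (k <= n)%N -> (forall x, 0 <= partial_mom w k f x) /\
    exists x, 0 < partial_mom w k f x.
  elim: k => [|k IH] kn.
    by split=> [x|]; [|exists x0]; rewrite partial_mom0.
  have [kge0 [x xP]] := IH (ltnW kn); pose K := Ordinal kn.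
  have step y : partial_mom w k.+1 f y = gauss1 (partial_poly w K f y).
    rewrite (@coef_partial_poly w K f y (@gauss1 R)) //.
    - exact: gauss1_is_linear.
    - exact: gauss1Xn.
  have pos y : 0 <= partial_mom w k.+1 f y /\ (0 < partial_mom w k f y ->
     0 < partial_mom w k.+1 f y).
    have py t : 0 <= (partial_poly w K f y).[t] by rewrite horner_partial_poly.
    rewrite step; have [p0|pn0] := eqVneq (partial_poly w K f y) 0.
      rewrite p0 gauss10; split => //.
      have := horner_partial_poly w K f y (y K); rewrite p0 horner0.
      by rewrite (eq_partial_mom _ _ _ (upd_id y K)) => <-; rewrite ltxx.
    have := gauss1_sqr_mul_gt0 (oner_neq0 _) pn0 py; rewrite !mul1r => h.
    by split => //; exact: ltW.
  by split => [y|]; [exact: (pos y).1|exists x; exact: (pos x).2].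
have [_ [x]] := wn n (leqnn n); by rewrite partial_momn.
Qed.

Lemma gaussE_ge0 f : (forall x, 0 <= f.@[x]) -> 0 <= gaussE f.
Proof.
move=> f0; have [->|fn0] := eqVneq f 0; first by rewrite /gaussE mlin0.
have [x fx] : exists x, f.@[x] != 0.
  apply: contrapT => /forallNP h; case/eqP: fn0; apply: mpoly_meval0 => x.
  by apply/eqP/negPn/negP; exact: h.
apply: ltW; apply: (@gaussE_gt0 _ x) => //; by rewrite lt_def fx f0.
Qed.

Lemma gaussE_mulX i f : gaussE ('X_i * f) = gaussE f^`M(i).
Proof.
move: f; apply: eq_linear_mpoly => [c p q|c p q|m].
- by rewrite mulrDr -scalerAr /gaussE linearP.
- by rewrite linearP /gaussE linearP.
rewrite -mpolyXD mderivX /gaussE mlinZ !mlinX (bigD1 i) //=.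
rewrite [X in _ = _ * X](bigD1 i) //= !mulrA; congr (_ * _); last first.
  by apply: eq_bigr => j ji; rewrite mnmDE mnmBE mnm1E eq_sym (negPf ji) subn0.
rewrite mnmDE mnmBE mnm1E eqxx add1n; case: (m i) => [|a].
  by rewrite mul0r.
by rewrite subn1.
Qed.

(* Infinitesimal rotations: they annihilate |x|^2 and preserve degrees, and
   rotation invariance of a mean is its vanishing on their values. *)
Definition rotd (j l : 'I_n) f : {mpoly R[n]} := 'X_j * f^`M(l) - 'X_l * f^`M(j).

Lemma gaussE_rotd j l f : gaussE (rotd j l f) = 0.
Proof.
by rewrite /rotd {1}/gaussE mlinB -!/(gaussE _) !gaussE_mulX mderiv_comm subrr.
Qed.

Lemma mulX_mderivX (j : 'I_n) m :
  'X_j * ('X_[m])^`M(j) = (m j)%:R *: 'X_[m] :> {mpoly R[n]}.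
Proof.
rewrite mderivX -scalerAr -mpolyXD; case mj: (m j) => [|a]; first by rewrite !scale0r.
by congr (_ *: 'X_[_]); rewrite addmC submK // lep1mP mj.
Qed.

Lemma euler_homog d f : f \is d.-homog ->
  \sum_j 'X_j * f^`M(j) = d%:R *: f.
Proof.
move=> /dhomogP fd; rewrite [in RHS](mpolyE f) scaler_sumr.
under eq_bigr => j _.
  rewrite {1}(mpolyE f) raddf_sum mulr_sumr; under eq_bigr => m _ do
    rewrite /= mderivZ -scalerAr mulX_mderivX; over.
rewrite exchange_big /= big_seq [RHS]big_seq; apply: eq_bigr => m mf.
rewrite -scaler_sumr -scaler_suml -natr_sum -mdegE.
by have /= -> := fd _ mf; rewrite !scalerA mulrC.
Qed.

Definition sqnorm : {mpoly R[n]} := \sum_j 'X_j ^+ 2.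

(** Integration by parts turns the mean of |x|^2 f into that of the divergence of x f, which is (n +
    d) f by Euler's identity. *)
Lemma gaussE_sqnorm d f : f \is d.-homog ->
  gaussE (sqnorm * f) = (n + d)%:R * gaussE f.
Proof.
move=> fd; rewrite /sqnorm mulr_suml {1}/gaussE mlin_sum.
under eq_bigr => j _.
  rewrite -/(gaussE _) expr2 -mulrA gaussE_mulX mderivM; over.
rewrite -[LHS](mlin_sum) big_split /= (euler_homog fd) mlinD mlinZ natrD mulrDl.
congr (_ + _); rewrite mlin_sum -[n in n%:R]card_ord -sumr_const mulr_suml.
apply: eq_bigr => j _; rewrite mderivX mnmE eqxx.
have -> : (U_(j) - U_(j) = 0 :> 'X_{1..n})%MM.
  by apply/mnmP => i; rewrite mnmBE subnn mnm0E.
by rewrite scale1r mpolyX0 !mul1r.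
Qed.

End MLin.

(** * Landau kernels *)

Section Landau.
Variable R : realType.
Implicit Types f g : {poly R}.

Definition primitive_poly f : {poly R} :=
  \poly_(i < (size f).+1) (if i is j.+1 then f`_j / j.+1%:R else 0).

Lemma deriv_primitive_poly f : (primitive_poly f)^`() = f.
Proof.
apply/polyP => i; rewrite coef_deriv coef_poly ltnS.
case: ltnP => [_|/(nth_default 0) ->]; last by rewrite mul0rn.
by rewrite -[LHS]mulr_natr divfK // pnatr_eq0.
Qed.

Lemma primitive_poly0 f : (primitive_poly f).[0] = 0.
Proof. by rewrite horner_coef0 coef_poly. Qed.

Lemma deriv0_horner f x y : f^`() = 0 -> f.[x] = f.[y].
Proof.
move=> f'0; have : size f^`() = 0 by rewrite f'0 size_poly0.
rewrite polyorder.size_deriv => sf; have /size1_polyC -> : (size f <= 1)%N by rewrite -subn_eq0 subn1 sf.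
by rewrite !hornerC.
Qed.

Lemma horner_le f a b x y :
  (forall t, a <= t <= b -> 0 <= f^`().[t]) -> a <= x -> x <= y -> y <= b ->
  f.[x] <= f.[y].
Proof.
move=> f0 ax xy yb; apply: (@ler_hornerW _ a b) => //.
- by move=> t; rewrite in_itv /= => /andP[/ltW at_ /ltW tb]; apply: f0; rewrite at_.
- by rewrite in_itv /= ax (le_trans xy).
- by rewrite in_itv /= yb andbT (le_trans ax).
Qed.

Lemma bernoulli_ineq (h : R) N : 0 <= h -> 1 + N%:R * h <= (1 + h) ^+ N.
Proof.
move=> h0; elim: N => [|N IH]; first by rewrite mul0r addr0.
rewrite exprS -natr1; apply: (le_trans _ (ler_wpM2l _ IH)); last by lra.
have := mulr_ge0 (ler0n R N) (sqr_ge0 h); lra.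
Qed.

(** With h = k^2/2 one has (1 - k^2)(1 + h)^2 <= 1, so the power is at most y^-2 for y = (1 + h)^N.
    By Bernoulli y >= (N + 1) h, and [N] is taken so large that N + 1 <= k y^2. *)
Lemma geometric_small (k : R) : 0 < k -> k < 1 ->
  exists N, N.+1%:R * (1 - k ^+ 2) ^+ N <= k.
Proof.
move=> k0 k1; pose h := k ^+ 2 / 2.
have h0 : 0 < h by rewrite divr_gt0 // exprn_gt0.
have h1 : h < 1 by rewrite /h; nra.
have hk0 : 0 < h * h * k by exact: mulr_gt0 (mulr_gt0 h0 h0) k0.
pose N := Num.truncn (h * h * k)^-1; exists N.
have NP : (h * h * k)^-1 < N.+1%:R by exact: truncnS_gt.
have bN : 1 + N%:R * h <= (1 + h) ^+ N by apply: bernoulli_ineq; exact: ltW.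
have [r0 t0] : 0 <= 1 - k ^+ 2 /\ 0 <= 1 - h by split; rewrite /h; nra.
set y := (1 + h) ^+ N in bN.
have Nh : N.+1%:R * h <= 1 + N%:R * h by rewrite -natr1; nra.
have y0 : 0 < y by rewrite exprn_gt0 //; lra.
have rN : (1 - k ^+ 2) ^+ N * (y * y) <= 1.
  rewrite -expr2 /y -!exprM mulnC exprM -exprMn exprn_ile1 //.
    by rewrite mulr_ge0 // exprn_ge0 //; lra.
  rewrite /h; set k2 := k ^+ 2; have k2_0 : 0 < k2 by rewrite exprn_gt0.
  have k21 : k2 < 1 by rewrite /k2; nra.
  nra.
have big : N.+1%:R <= k * (y * y).
  have a1 : N.+1%:R * h <= y by exact: le_trans bN.
  have a2 : 1 <= k * h * (N.+1%:R * h).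
    have := NP; rewrite -[in X in X -> _](ltr_pM2l hk0) mulfV ?gt_eqF // => /ltW.
    by rewrite (_ : k * h * _ = h * h * k * N.+1%:R) //; ring.
  have a3 : 1 <= k * h * y.
    by apply: (le_trans a2); rewrite ler_pM2l // mulr_gt0.
  have N0 : 0 < N.+1%:R :> R by rewrite ltr0n.
  have a4 : N.+1%:R * 1 <= N.+1%:R * (k * h * y) by rewrite ler_pM2l.
  have a5 : (k * y) * (N.+1%:R * h) <= (k * y) * y by rewrite ler_pM2l // mulr_gt0.
  lra.
have e0 : 0 <= (1 - k ^+ 2) ^+ N by rewrite exprn_ge0.
apply: (le_trans (ler_wpM2r e0 big)).
by rewrite -mulrA [y * y * _]mulrC -[leRHS]mulr1 ler_pM2l.
Qed.

(* Landau kernels: polynomials [f] approximating [|s|] on [-1, 1], with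
   [f^`(2)] proportional to [(1 - s^2)^N]. *)
Lemma landau_half (k : R) : 0 < k -> k < 1 -> exists f,
  [/\ forall s, f.[- s] = f.[s], forall s, f^`().[- s] = - f^`().[s],
      forall s, f^`()^`().[- s] = f^`()^`().[s] &
  forall s, 0 <= s <= 1 ->
   [/\ 0 <= f^`()^`().[s], k <= s -> f^`()^`().[s] <= k,
      0 <= f.[s], f.[s] <= s & [/\ f.[s] <= f^`().[s] * s,
      f^`().[s] * s <= s & s - k *+ 2 <= f.[s] ] ] ].
Proof.
move=> k0 k1; have [N NP] := geometric_small k0 k1.
pose g : {poly R} := (1 - 'X ^+ 2) ^+ N.
have gE s : g.[s] = (1 - s ^+ 2) ^+ N by rewrite /g !hornerE.
pose G := primitive_poly g; have G' : G^`() = g by exact: deriv_primitive_poly.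
have G0 : G.[0] = 0 by exact: primitive_poly0.
have g0 s : 0 <= s <= 1 -> 0 <= g.[s].
  by move=> /andP[s0 s1]; rewrite gE exprn_ge0 //; nra.
(* On [0, 1], (1 - t^2)^N >= (1 - t)^N, whose integral is 1/(N + 1); [H] is the primitive of the
   difference, up to a constant. *)
have I1 : N.+1%:R^-1 <= G.[1].
  pose H : {poly R} := G + N.+1%:R^-1 *: (1 - 'X) ^+ N.+1.
  have -> : G.[1] = H.[1] by rewrite /H !hornerE subrr expr0n /= mulr0 addr0.
  have -> : N.+1%:R^-1 = H.[0] by rewrite /H !hornerE G0 subr0 expr1n mulr1 add0r.
  apply: (@horner_le _ 0 1) => // t /andP[t0 t1].
  have d1 : (1 - 'X : {poly R})^`() = -1 by rewrite derivB -polyC1 derivC derivX sub0r.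
  rewrite /H derivD G' derivZ deriv_exp d1 mulN1r hornerD gE hornerZ hornerMn hornerN horner_exp.
  rewrite -[X in _ * X]mulr_natl mulrA mulVf ?pnatr_eq0 // mul1r !hornerE subr_ge0 lerXn2r // ?nnegrE; nra.
have I0 : 0 < G.[1] by apply: lt_le_trans I1; rewrite invr_gt0 ltr0n.
(* Normalized so that f'(1) = 1; then f' increases from 0 to 1 on [0, 1]. *)
pose h := G.[1]^-1 *: G; pose f := primitive_poly h.
have f' : f^`() = h by exact: deriv_primitive_poly.
have f0 : f.[0] = 0 by exact: primitive_poly0.
have f'' s : f^`()^`().[s] = (1 - s ^+ 2) ^+ N / G.[1].
  by rewrite f' /h derivZ G' hornerZ gE mulrC.
have Godd s : G.[- s] = - G.[s].
  have : (G + (G \Po (- 'X))).[s] = (G + (G \Po (- 'X))).[0].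
    apply: deriv0_horner; rewrite derivD deriv_comp G' derivN derivX mulrN1.
    apply: poly_horner_inj => t.
    by rewrite hornerD hornerN horner_comp !gE hornerN hornerX sqrrN horner0 subrr.
  by rewrite !hornerD !horner_comp !hornerE oppr0 G0 addr0 => /eqP; rewrite addrC addr_eq0 => /eqP.
have hodd s : h.[- s] = - h.[s] by rewrite /h !hornerZ Godd mulrN.
have feven s : f.[- s] = f.[s].
  have : (f - (f \Po (- 'X))).[s] = (f - (f \Po (- 'X))).[0].
    apply: deriv0_horner; rewrite derivB deriv_comp f' derivN derivX mulrN1 opprK.
    apply: poly_horner_inj => t.
    by rewrite hornerD horner_comp hornerN hornerX hodd horner0 subrr.
  by rewrite !hornerD !hornerN !horner_comp !hornerE oppr0 f0 subr0 => /eqP; rewrite subr_eq0 => /eqP.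
exists f; split => //.
- by move=> s; rewrite f'.
- by move=> s; rewrite !f'' sqrrN.
have f''0 s : 0 <= s <= 1 -> 0 <= f^`()^`().[s].
  by move=> s01; rewrite f'' -gE divr_ge0 ?g0 // ltW.
(* Dividing by [G.[1]] costs at most a factor N + 1, which the choice of [N] absorbs. *)
have f''k s : k <= s -> s <= 1 -> f^`()^`().[s] <= k.
  move=> ks s1; rewrite f'' ler_pdivrMr //.
  have r1 : (1 - s ^+ 2) ^+ N <= (1 - k ^+ 2) ^+ N.
    by rewrite lerXn2r // ?nnegrE; nra.
  apply: (le_trans r1); rewrite -(@ler_pM2l _ N.+1%:R) ?ltr0n //.
  apply: (le_trans NP); rewrite mulrCA -[leLHS]mulr1 ler_pM2l //.
  by rewrite -(@ler_pM2l _ N.+1%:R^-1) ?invr_gt0 ?ltr0n // mulr1 mulKf ?pnatr_eq0.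
have f'0 : f^`().[0] = 0 by rewrite f' /h hornerZ G0 mulr0.
have f'1 : f^`().[1] = 1 by rewrite f' /h hornerZ mulVf ?gt_eqF.
have f'ge s : 0 <= s -> s <= 1 -> 0 <= f^`().[s].
  by move=> s0 s1; rewrite -f'0; apply: (@horner_le _ 0 1).
have f'le s : 0 <= s -> s <= 1 -> f^`().[s] <= 1.
  by move=> s0 s1; rewrite -f'1; apply: (@horner_le _ 0 1).
have fge s : 0 <= s -> s <= 1 -> 0 <= f.[s].
  move=> s0 s1; rewrite -f0; apply: (@horner_le _ 0 1) => // t /andP[t0 t1].
  exact: f'ge.
move=> s /andP[s0 s1]; split; [by apply: f''0; rewrite s0|by move=> ks; apply: f''k|exact: fge| |split].
- have := @horner_le ('X - f) 0 1 0 s; rewrite !hornerD !hornerN !hornerX f0 subrr => h0.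
  rewrite -subr_ge0; apply: h0 => // t /andP[t0 t1].
  by rewrite derivB derivX !hornerE subr_ge0 f'le.
- have := @horner_le (f^`() * 'X - f) 0 1 0 s; rewrite !hornerD !hornerN !hornerM !hornerX f0 mulr0 subrr => h0.
  rewrite -subr_ge0; apply: h0 => // t /andP[t0 t1].
  rewrite derivB derivM derivX mulr1 addrK hornerM hornerX mulr_ge0 //.
  by apply: f''0; rewrite t0.
- by rewrite -[leRHS]mul1r ler_wpM2r // f'le.
have [sk|ks] := ltP s k.
  by apply: (le_trans _ (fge s s0 s1)); lra.
(* Beyond [k] the second derivative is at most [k], so f' stays above 1 - k. Hence f(s) >= (1 - k)(s
   - k) >= s - 2k. *)
have f'k t : k <= t -> t <= 1 -> 1 - k <= f^`().[t].
  move=> kt t1.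
  have := @horner_le (k *: 'X - f^`()) k 1 t 1; rewrite !hornerD !hornerN !hornerZ !hornerX f'1 => h0.
  have : k * t - f^`().[t] <= k * 1 - 1.
    apply: h0 => // u /andP[ku u1].
    by rewrite derivB derivZ derivX !hornerE subr_ge0 f''k.
  have := mulr_ge0 (ltW k0) (le_trans (ltW k0) kt); lra.
have := @horner_le (f - (1 - k) *: 'X) k 1 k s; rewrite !hornerD !hornerN !hornerZ !hornerX => h0.
have : f.[k] - (1 - k) * k <= f.[s] - (1 - k) * s.
  apply: h0 => // u /andP[ku u1].
  by rewrite derivB derivZ derivX !hornerE subr_ge0 f'k.
have := fge k (ltW k0) (ltW k1); nra.
Qed.

Lemma landau (k : R) : 0 < k -> k < 1 -> exists f,
  forall s, `|s| <= 1 ->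
   [/\ 0 <= f^`()^`().[s], k <= `|s| -> f^`()^`().[s] <= k,
      0 <= f.[s], f.[s] <= `|s| & [/\ f.[s] <= f^`().[s] * s,
      f^`().[s] * s <= `|s| & `|s| - k <= f.[s] ] ].
Proof.
move=> k0 k1; have [||f [fe f'o f''e fP]] := @landau_half (k / 2); [lra|lra|].
exists f => s s1.
have := fP `|s|; rewrite s1 normr_ge0 => /(_ isT).
have -> : k / 2 *+ 2 = k by rewrite -mulr_natr divfK // pnatr_eq0.
have [s0|s0] := leP 0 s.
  rewrite ger0_norm // => -[h1 h2 h3 h4 h5]; split => // ks.
  by apply: (le_trans (h2 _)); lra.
rewrite ltr0_norm // fe f'o f''e mulrNN => -[h1 h2 h3 h4 h5]; split => // ks.
by apply: (le_trans (h2 _)); lra.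
Qed.

End Landau.

(** * The spherical mean and the spherical Laplacian *)

Section Sphere.
Variables (R : realType) (n : nat).
Implicit Types (p q f g u v : {mpoly R[n]}) (x : 'I_n -> R).

(* [sphc t] is the ratio of the Gaussian mean to the mean over
   the sphere on homogeneous polynomials of degree [2 t]. *)
Definition sphc (t : nat) : R := \prod_(i < t) (n + i.*2)%:R.

(** The mean over the unit sphere, monomial by monomial: the Gaussian mean without its radial
    factor. In odd degree the Gaussian moment is 0, so the rounding in the half degree is
    harmless. *)
Definition sphE f : R :=
  mlin (fun m => (\prod_(j < n) gauss_moment R (m j)) / sphc (mdeg m)./2) f.

Lemma sphc_gt0 t : (0 < n)%N -> 0 < sphc t.
Proof. by move=> n0; apply: prodr_gt0 => i _; rewrite ltr0n addn_gt0 n0. Qed.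

Lemma sphcS t : sphc t.+1 = sphc t * (n + t.*2)%:R.
Proof. by rewrite /sphc big_ord_recr. Qed.

Lemma sphE_homog d f : f \is d.-homog -> sphE f = gaussE f / sphc d./2.
Proof.
move=> /dhomogP fd; rewrite /sphE /gaussE /mlin big_seq [in RHS]big_seq mulr_suml.
by apply: eq_bigr => m mf; have /= -> := fd _ mf; rewrite mulrA.
Qed.

Lemma sphED f g : sphE (f + g) = sphE f + sphE g. Proof. exact: mlinD. Qed.
Lemma sphEB f g : sphE (f - g) = sphE f - sphE g. Proof. exact: mlinB. Qed.
Lemma sphEZ c f : sphE (c *: f) = c * sphE f. Proof. exact: mlinZ. Qed.
Lemma sphE_sum (I : Type) (r : seq I) (P : pred I) (F : I -> {mpoly R[n]}) :
  sphE (\sum_(i <- r | P i) F i) = \sum_(i <- r | P i) sphE (F i).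
Proof. exact: mlin_sum. Qed.

Lemma rotd_linear (j l : 'I_n) c f g :
  rotd j l (c *: f + g) = c *: rotd j l f + rotd j l g.
Proof.
rewrite /rotd !mderivD !mderivZ !mulrDr -!scalerAr scalerBr.
by rewrite opprD addrACA.
Qed.

Lemma rotdM (j l : 'I_n) f g : rotd j l (f * g) = rotd j l f * g + f * rotd j l g.
Proof. by rewrite /rotd !mderivM; ring. Qed.

Lemma rotdX_homog (j l : 'I_n) (m : 'X_{1..n}) :
  rotd j l ('X_[m] : {mpoly R[n]}) \is (mdeg m).-homog.
Proof.
have h (a b : 'I_n) : ('X_a * ('X_[m])^`M(b) : {mpoly R[n]}) \is (mdeg m).-homog.
  rewrite mderivX -scalerAr -mpolyXD; case mb: (m b) => [|c].
    by rewrite scale0r dhomog0.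
  apply: dhomogZ; rewrite dhomogX /= mdegD mdeg1.
  have -> : mdeg m = mdeg (m - U_(b) + U_(b))%MM by rewrite submK // lep1mP mb.
  by rewrite mdegD mdeg1 addnC.
by rewrite /rotd rpredB // h.
Qed.

(** [rotd] preserves the degree, and on each degree [sphE] is a multiple of [gaussE]. *)
Lemma sphE_rotd (j l : 'I_n) f : sphE (rotd j l f) = 0.
Proof.
pose z : {mpoly R[n]} -> R := fun=> 0.
move: f; apply: (@eq_linear_mpoly _ _ (fun f => sphE (rotd j l f)) z) => [c f g|c f g|m].
- by rewrite rotd_linear sphED sphEZ.
- by rewrite /z mulr0 addr0.
by rewrite (sphE_homog (rotdX_homog _ _ _)) gaussE_rotd mul0r.
Qed.

Lemma sqnorm_homog : sqnorm R n \is 2.-homog.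
Proof.
apply: rpred_sum => i _; rewrite mpolyXn dhomogX /=.
by rewrite mdegMn mdeg1.
Qed.

Lemma meval_sqnorm x : (sqnorm R n).@[x] = \sum_j x j ^+ 2.
Proof.
rewrite /sqnorm raddf_sum /=; apply: eq_bigr => j _.
by rewrite rmorphXn /= mevalXU.
Qed.

Lemma gaussE_sqnormX e t f : f \is (t.*2).-homog ->
  sphc t * gaussE (sqnorm R n ^+ e * f) = sphc (t + e) * gaussE f.
Proof.
move=> fh; elim: e => [|e IH]; first by rewrite mul1r addn0.
have h : sqnorm R n ^+ e * f \is (2 * e + t.*2).-homog.
  by apply: dhomogM => //; apply: dhomogMn sqnorm_homog.
rewrite exprS -mulrA (gaussE_sqnorm h) mulrCA IH addnS sphcS.
by rewrite (_ : 2 * e + t.*2 = (t + e).*2)%N; [ring|lia].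
Qed.

Lemma gauss_moment_odd a : odd a -> gauss_moment R a = 0.
Proof.
have [N] := ubnP a; elim: N a => // N IH [|[|a]] //=.
by rewrite ltnS negbK => aN oa; rewrite (IH a _ oa) ?mulr0 //; lia.
Qed.

Lemma gauss_prod_odd (m : 'X_{1..n}) :
  odd (mdeg m) -> \prod_(j < n) gauss_moment R (m j) = 0.
Proof.
move=> om; have /existsP[j jo] : [exists j, odd (m j)].
  apply: contraT; rewrite negb_exists => /forallP h.
  move: om; rewrite mdegE (big_morph odd oddD (erefl : odd 0 = false)).
  by rewrite big1 // => j _; apply/negbTE.
by rewrite (bigD1 j) //= gauss_moment_odd // mul0r.
Qed.

(* [f] may be replaced by its even part, made homogeneous by powers of |x|^2. *)
Lemma sphE_ge0 f : (0 < n)%N ->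
  (forall x, \sum_j x j ^+ 2 = 1 -> 0 <= f.@[x]) -> 0 <= sphE f.
Proof.
move=> n0 f0; pose D := msize f.
pose ev := [pred m : 'X_{1..n} | ~~ odd (mdeg m)].
pose fh := \sum_(m <- msupp f | ev m)
  f@_m *: (sqnorm R n ^+ (D - (mdeg m)./2) * 'X_[m]).
have fhE : gaussE fh = sphc D * sphE f.
  rewrite /gaussE mlin_sum /sphE [in RHS]/mlin mulr_sumr [RHS](bigID ev) /=.
  rewrite [X in _ = _ + X]big1 ?addr0; last first.
    by move=> m /negPn om; rewrite gauss_prod_odd // mul0r !mulr0.
  rewrite big_seq_cond [RHS]big_seq_cond; apply: eq_bigr => m /andP[mf em].
  rewrite mlinZ mulrCA; congr (_ * _).
  set e := (D - _)%N; have mh : ('X_[m] : {mpoly R[n]}) \is ((mdeg m)./2.*2).-homog.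
    by rewrite dhomogX /= even_halfK.
  have := gaussE_sqnormX e mh; rewrite subnKC; last first.
    by have := msize_mdeg_lt mf; rewrite -/D; lia.
  have t0 : sphc (mdeg m)./2 != 0 by rewrite gt_eqF ?sphc_gt0.
  rewrite /gaussE mlinX => h; apply: (mulfI t0).
  by rewrite h; field.
have fh0 x : 0 <= fh.@[x].
  pose r := \sum_j x j ^+ 2.
  have r0 : 0 <= r by apply: sumr_ge0 => j _; exact: sqr_ge0.
  have fhx : fh.@[x] = \sum_(m <- msupp f | ev m)
      f@_m * (r ^+ (D - (mdeg m)./2) * \prod_(j < n) x j ^+ m j).
    rewrite /fh raddf_sum /=; apply: eq_bigr => m _.
    by rewrite mevalZ mevalM rmorphXn /= meval_sqnorm mevalX.
  (* At the origin every term of [fh] vanishes: [D] exceeds all degrees of [f], so the exponents of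
     |x|^2 are positive. *)
  have [rz|rn0] := eqVneq r 0.
    rewrite fhx rz big_seq_cond big1 // => m /andP[mf em].
    have := msize_mdeg_lt mf; rewrite -/D => mD.
    by rewrite expr0n (_ : _ == _ = false) ?mul0r ?mulr0 //; apply/eqP; lia.
  have rp : 0 < r by rewrite lt_def rn0.
  pose s := Num.sqrt r; have s0 : 0 < s by rewrite sqrtr_gt0.
  have s2 : s ^+ 2 = r by rewrite sqr_sqrtr.
  have onS c : c ^+ 2 = 1 -> \sum_j (c * x j / s) ^+ 2 = 1.
    move=> c2; under eq_bigr => j _ do rewrite exprMn exprMn c2 mul1r exprVn s2.
    by rewrite -mulr_suml divff.
  have fE c : c ^+ 2 = 1 -> f.@[fun j => c * x j / s] = \sum_(m <- msupp f)
     f@_m * (c ^+ mdeg m * s ^- mdeg m * \prod_(j < n) x j ^+ m j).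
    move=> c2; rewrite mevalE; apply: eq_bigr => m _; congr (_ * _).
    under eq_bigr => j _ do rewrite exprMn exprMn mulrAC.
    rewrite big_split /= mdegE; congr (_ * _).
    have h (a b : R) : \prod_(i < n) (a ^+ m i * b ^+ m i)
        = a ^+ (\sum_(i < n) m i) * b ^+ (\sum_(i < n) m i).
      by rewrite big_split /= !prodrXr.
    by rewrite h exprVn.
  (* Averaging [f] over the antipodal points x/|x| and -x/|x| of the sphere cancels the odd
     degrees. *)
  have -> : fh.@[x] = r ^+ D * ((f.@[fun j => 1 * x j / s] + f.@[fun j => -1 * x j / s]) / 2).
    rewrite fhx !fE ?expr1n ?sqrrN ?expr1n // -big_split /= mulr_suml mulr_sumr.
    rewrite [RHS](bigID ev) /= [X in _ = _ + X]big1 ?addr0; last first.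
      move=> m /negPn om; rewrite expr1n -signr_odd om expr1.
      by rewrite mul1r mulN1r mulNr mulrN addrN mul0r mulr0.
    rewrite big_seq_cond [RHS]big_seq_cond; apply: eq_bigr => m /andP[mf em].
    rewrite expr1n -signr_odd (negPf em) expr0.
    have -> : s ^- mdeg m = r ^- (mdeg m)./2.
      by rewrite -s2 -exprM mul2n even_halfK.
    have mD : ((mdeg m)./2 <= D)%N by have := msize_mdeg_lt mf; rewrite -/D; lia.
    rewrite -[in RHS](subnK mD) exprD; set P := \prod_(j < n) _.
    have : r ^+ (mdeg m)./2 != 0 by rewrite expf_neq0.
    move: (r ^+ _) (r ^+ _) (f@_m) P => a b c P b0; field.
    by [].
  rewrite mulr_ge0 ?exprn_ge0 // divr_ge0 // addr_ge0 // f0 // onS ?sqrrN ?expr1n //.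
have := gaussE_ge0 fh0; rewrite fhE pmulr_rge0 //; exact: sphc_gt0.
Qed.

Lemma sphE_le f g : (0 < n)%N ->
  (forall x, \sum_j x j ^+ 2 = 1 -> f.@[x] <= g.@[x]) -> sphE f <= sphE g.
Proof.
move=> n0 fg; rewrite -subr_ge0 -sphEB; apply: sphE_ge0 => // x x1.
by rewrite mevalB subr_ge0 fg.
Qed.

Lemma sphE_sqr_gt0 d f : (0 < n)%N -> f \is d.-homog -> f != 0 -> 0 < sphE (f * f).
Proof.
move=> n0 fd f0; rewrite (sphE_homog (dhomogM fd fd)) divr_gt0 ?sphc_gt0 //.
have [x fx] : exists x, f.@[x] != 0.
  apply: contrapT => /forallNP h; case/eqP: f0; apply: mpoly_meval0 => x.
  by apply/eqP/negPn/negP; exact: h.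
apply: (@gaussE_gt0 _ _ _ x) => [y|]; rewrite mevalM -expr2 ?sqr_ge0 //.
by rewrite exprn_even_gt0.
Qed.

(** On the sphere this is twice the Laplace-Beltrami operator, since each pair of indices is counted
    in both orders; hence the factor 2 in [sph_eigen]. *)
Definition sphLap f : {mpoly R[n]} := \sum_j \sum_l rotd j l (rotd j l f).

(** Green's identity: each [rotd j l] is a derivation whose values have mean 0, so integration by
    parts gives an expression symmetric in [u] and [v]. *)
Lemma sphE_Lap_sym u v : sphE (u * sphLap v) = sphE (v * sphLap u).
Proof.
have key f g : sphE (f * sphLap g) = - \sum_j \sum_l sphE (rotd j l f * rotd j l g).
  rewrite /sphLap mulr_sumr sphE_sum -sumrN; apply: eq_bigr => j _.
  rewrite mulr_sumr sphE_sum -sumrN; apply: eq_bigr => l _.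
  apply/eqP; rewrite -addr_eq0 addrC -sphED -rotdM.
  by rewrite sphE_rotd.
rewrite !key; congr (- _); apply: eq_bigr => j _; apply: eq_bigr => l _.
by rewrite mulrC.
Qed.

Definition sph_eigen (d : nat) : nat := 2 * (d * (d + n - 2)).

(** When the squares are expanded, the terms containing the Laplacian of [f] vanish, and the others
    are expressed by the Euler sum [E] and its second-order analogue [S], both multiples of [f]. *)
Lemma sphLap_homog d f : (2 <= n)%N -> harmonic f -> f \is d.-homog ->
  sphLap f = - ((sph_eigen d)%:R *: f).
Proof.
move=> n2 hf fd; pose E := \sum_j 'X_j * f^`M(j).
have EE : E = d%:R *: f by exact: euler_homog.
pose S := \sum_j \sum_l ('X_j * 'X_l * (f^`M(j))^`M(l)) : {mpoly R[n]}.
have dX (j l : 'I_n) : ('X_j)^`M(l) = (j == l)%:R :> {mpoly R[n]}.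
  rewrite mderivX mnm1E; case: eqP => [->|_]; last by rewrite scale0r.
  have -> : (U_(l) - U_(l) = 0 :> 'X_{1..n})%MM.
    by apply/mnmP => i; rewrite mnmBE subnn mnm0E.
  by rewrite scale1r mpolyX0.
have SE : S = d%:R *: E - E.
  have e2 : \sum_l 'X_l * E^`M(l) = d%:R *: E.
    rewrite EE; under eq_bigr => l _ do rewrite mderivZ -scalerAr.
    by rewrite -scaler_sumr -/E EE.
  apply/eqP; rewrite eq_sym subr_eq -e2 /S exchange_big -big_split /=; apply/eqP.
  apply: eq_bigr => l _; rewrite /E raddf_sum mulr_sumr /=.
  have -> : 'X_l * f^`M(l) = \sum_j 'X_l * ((j == l)%:R * f^`M(j)).
    rewrite (bigD1 l) //= eqxx mul1r big1 ?addr0 // => j /negPf ->.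
    by rewrite mul0r mulr0.
  rewrite -big_split /=; apply: eq_bigr => j _.
  by rewrite mderivM dX; ring.
have -> : sphLap f = \sum_j \sum_l
   (((j == l)%:R * ('X_j * f^`M(l)) + (j == l)%:R * ('X_l * f^`M(j)))
    - ('X_j * f^`M(j)) - ('X_l * f^`M(l)) - ('X_j * 'X_l * (f^`M(j))^`M(l)) *+ 2
    + ('X_j ^+ 2 * (f^`M(l))^`M(l) + 'X_l ^+ 2 * (f^`M(j))^`M(j))).
  apply: eq_bigr => j _; apply: eq_bigr => l _.
  rewrite /rotd !mderivB !mderivM !dX eqxx (eq_sym l j) eqxx.
  by rewrite (mderiv_comm l j) mulr1n; ring.
have lap0 (c : {mpoly R[n]}) : \sum_l c * (f^`M(l))^`M(l) = 0.
  by rewrite -mulr_sumr hf mulr0.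
have diag (F : 'I_n -> 'I_n -> {mpoly R[n]}) :
    \sum_j \sum_l (j == l)%:R * F j l = \sum_j F j j.
  apply: eq_bigr => j _; rewrite (bigD1 j) //= eqxx mul1r big1 ?addr0 // => l.
  by rewrite eq_sym => /negPf ->; rewrite mul0r.
under eq_bigr => j _ do rewrite !big_split /= !sumrN.
rewrite !big_split /= !sumrN !diag.
have -> : \sum_(j < n) \sum_(l < n) 'X_j ^+ 2 * (f^`M(l))^`M(l) = 0.
  by rewrite big1 // => j _; rewrite lap0.
have -> : \sum_(j < n) \sum_(l < n) 'X_l ^+ 2 * (f^`M(j))^`M(j) = 0.
  by rewrite exchange_big big1 // => j _; rewrite lap0.
have -> : \sum_(j < n) \sum_(l < n) 'X_j * f^`M(j) = E *+ n.
  by under eq_bigr => j _ do rewrite sumr_const card_ord; rewrite -sumrMnl.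
have -> : \sum_(j < n) \sum_(l < n) 'X_l * f^`M(l) = E *+ n.
  by rewrite sumr_const card_ord.
have -> : \sum_(j < n) \sum_(l < n) 'X_j * 'X_l * (f^`M(j))^`M(l) *+ 2 = S *+ 2.
  by under eq_bigr => j _ do rewrite sumrMnl; rewrite sumrMnl.
rewrite -/E SE EE.
have -> : sph_eigen d = (2 * (d * d) + 2 * (n * d) - 4 * d)%N by rewrite /sph_eigen; nia.
have smul (c : R) k : c *: f *+ k = (k%:R * c) *: f by rewrite -scaler_nat scalerA.
rewrite !addr0 scalerA -scalerBl !smul.
have -> : d%:R *: f + d%:R *: f - (n%:R * d%:R) *: f - (n%:R * d%:R) *: f -
    (2 * (d%:R * d%:R - d%:R)) *: f = (d%:R + d%:R - n%:R * d%:R - n%:R * d%:R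
    - 2 * (d%:R * d%:R - d%:R)) *: f by rewrite !scalerBl scalerDl.
rewrite -[RHS]scaleNr; congr (_ *: _).
have le : (4 * d <= 2 * (d * d) + 2 * (n * d))%N by clear -n2; nia.
by rewrite natrB // natrD !natrM; ring.
Qed.

Definition polyapp (phi : {poly R}) f : {mpoly R[n]} :=
  (map_poly (@mpolyC n R) phi).[f].

Lemma polyapp_MXaddC phi c f : polyapp (phi * 'X + c%:P) f = polyapp phi f * f + c%:MP.
Proof.
by rewrite /polyapp rmorphD rmorphM /= map_polyX map_polyC hornerMXaddC.
Qed.

Lemma polyapp0 f : polyapp 0 f = 0.
Proof. by rewrite /polyapp rmorph0 horner0. Qed.

Lemma polyappD phi psi f : polyapp (phi + psi) f = polyapp phi f + polyapp psi f.
Proof. by rewrite /polyapp rmorphD hornerD. Qed.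

Lemma meval_polyapp phi f x : (polyapp phi f).@[x] = phi.[f.@[x]].
Proof.
elim/poly_ind: phi => [|phi c IH]; first by rewrite polyapp0 meval0 horner0.
by rewrite polyapp_MXaddC mevalD mevalM mevalC IH hornerMXaddC.
Qed.

Lemma rotdC (j l : 'I_n) c : rotd j l (c%:MP : {mpoly R[n]}) = 0.
Proof. by rewrite /rotd !mderivC !mulr0 subrr. Qed.

Lemma rotdD (j l : 'I_n) f g : rotd j l (f + g) = rotd j l f + rotd j l g.
Proof. by have := rotd_linear j l 1 f g; rewrite !scale1r. Qed.

Lemma rotd_polyapp (j l : 'I_n) phi f :
  rotd j l (polyapp phi f) = polyapp phi^`() f * rotd j l f.
Proof.
elim/poly_ind: phi => [|phi c IH].
  by rewrite polyapp0 deriv0 polyapp0 -(mpolyC0 n) rotdC mpolyC0 mul0r.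
rewrite polyapp_MXaddC rotdD rotdM rotdC addr0 IH.
rewrite derivD derivC addr0 derivM derivX mulr1 polyappD.
have -> : polyapp (phi^`() * 'X) f = polyapp phi^`() f * f.
  by have := polyapp_MXaddC phi^`() 0 f; rewrite mpolyC0 polyC0 !addr0.
ring.
Qed.

(** On the sphere, twice the squared length of the tangential gradient. *)
Definition sphGrad f : {mpoly R[n]} := \sum_j \sum_l rotd j l f ^+ 2.

Lemma sphLap_polyapp phi f : sphLap (polyapp phi f) =
  polyapp phi^`() f * sphLap f + polyapp phi^`()^`() f * sphGrad f.
Proof.
rewrite /sphLap /sphGrad !mulr_sumr -big_split; apply: eq_bigr => j _ /=.
rewrite !mulr_sumr -big_split; apply: eq_bigr => l _ /=.
by rewrite rotd_polyapp rotdM rotd_polyapp; ring.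
Qed.

Lemma sphGrad_ge0 f x : 0 <= (sphGrad f).@[x].
Proof.
rewrite /sphGrad raddf_sum; apply: sumr_ge0 => j _; rewrite raddf_sum.
by apply: sumr_ge0 => l _ /=; rewrite rmorphXn sqr_ge0.
Qed.

End Sphere.

(** * Homogeneous harmonic polynomials of different degrees have different zero sets *)

Section PointwiseEstimates.
Variable R : realType.
Implicit Types a b e k lm li fa fb ga gb g h M G : R.

(** [a] and [b] are values of p and q at a point, [fa] and [ga] stand for phi(a) and phi'(a) a with
    a Landau kernel phi, and likewise for [b]. Then [fb * ga] is at least |ab| - 2k, [fa * gb] is at
    most |ab|, and (ab)^2 <= |ab|. *)
Lemma landau_lower_bound lm li k a b fa fb ga gb :
  0 <= li -> li < lm -> 0 <= k -> `|a| <= 1 -> `|b| <= 1 ->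
  0 <= fa -> fa <= `|a| -> fa <= ga -> `|a| - k <= fa ->
  0 <= fb -> fb <= `|b| -> 0 <= gb -> gb <= `|b| -> `|b| - k <= fb ->
  (lm - li) * (a * b * (a * b)) - 2 * lm * k <= lm * (fb * ga) - li * (fa * gb).
Proof.
move=> li0 lm_li k0 bp bq a0 a1 a2 a4 b0 b1 b2 b3 b4.
have aa : 0 <= `|a| by []. have bb : 0 <= `|b| by [].
have e1 : fb * fa <= fb * ga by rewrite ler_wpM2l.
have e2 : fa * gb <= `|a| * `|b| by apply: ler_pM.
have e3 : `|a| * `|b| - k * 2 <= fb * fa.
  have h1 : 0 <= (fa - (`|a| - k)) * `|b| by rewrite mulr_ge0 ?subr_ge0.
  have h2 : 0 <= fa * (fb - (`|b| - k)) by rewrite mulr_ge0 ?subr_ge0.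
  have h3 : k * `|b| <= k by rewrite -[leRHS]mulr1 ler_wpM2l.
  have h4 : k * fa <= k by rewrite -[leRHS]mulr1 ler_wpM2l // (le_trans a1).
  lra.
have e4 : a * b * (a * b) <= `|a| * `|b|.
  have -> : a * b * (a * b) = (`|a| * `|b|) * (`|a| * `|b|).
    by rewrite -normrM -!expr2 real_normK ?num_real.
  by rewrite -[leRHS]mulr1 ler_wpM2l ?mulr_ge0 // -[1]mulr1 ler_pM.
have lm0 : 0 <= lm by exact: le_trans (ltW lm_li).
have f1 := ler_wpM2l lm0 (le_trans e3 e1).
have f2 := ler_wpM2l li0 e2.
have f3 : (lm - li) * (a * b * (a * b)) <= (lm - li) * (`|a| * `|b|).
  by rewrite ler_wpM2l // subr_ge0 ltW.
lra.
Qed.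

(** [h] is phi''(a) and [g] a squared gradient. Where |a| < k the factor [fb] is below [e];
    elsewhere the kernel [h] is at most [k]. *)
Lemma landau_upper_bound e k a b fb h g :
  0 <= e -> 0 <= k -> 0 <= g -> 0 <= h -> 0 <= fb -> fb <= `|b| -> `|b| <= 1 ->
  (`|a| < k -> `|b| < e) -> (k <= `|a| -> h <= k) ->
  fb * (h * g) <= e * (h * g) + k * g.
Proof.
move=> e0 k0 g0 h0 b0 b1 bb small big.
have hg : 0 <= h * g by rewrite mulr_ge0.
have kg : 0 <= k * g by rewrite mulr_ge0.
have ehg : 0 <= e * (h * g) by rewrite mulr_ge0.
have [/small be|/big hk] := ltP `|a| k.
  have : fb * (h * g) <= e * (h * g) by rewrite ler_wpM2r // (le_trans b1) // ltW.
  by lra.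
have : fb * (h * g) <= 1 * (h * g) by rewrite ler_wpM2r // (le_trans b1).
have : h * g <= k * g by rewrite ler_wpM2r.
lra.
Qed.

(** First [e] is fixed, then [k], at most [e] and the [eta] that belongs to it. The right-hand side
    is then at most e B = a/2. *)
Lemma vanishing_error_contradiction lm a M G (P : R -> R -> Prop) :
  0 < a -> 0 < lm -> 0 <= M -> 0 <= G ->
  (forall e, 0 < e -> exists2 eta, 0 < eta & forall k, k <= eta -> P e k) ->
  (forall e k, 0 < e -> 0 < k -> k < 1 -> P e k ->
     a <= 2 * lm * k * M + e * lm * M + k * G) -> False.
Proof.
move=> a0 lm0 M0 G0 small main.
have lM : 0 <= lm * M by rewrite mulr_ge0 // ltW.
pose B := 3 * (lm * M) + G + 1.
have B0 : 0 < B by rewrite /B; lra.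
pose e := a / (2 * B); have e0 : 0 < e by rewrite divr_gt0 // mulr_gt0.
have [eta eta0 etaP] := small e e0.
pose k := Num.min (Num.min eta e) (1 / 2).
have k0 : 0 < k by rewrite !lt_min eta0 e0 /=; lra.
have [k1 ke keta] : [/\ k < 1, k <= e & k <= eta].
  split; first by rewrite gt_min; apply/orP; right; lra.
    by rewrite !ge_min lexx !orbT.
  by rewrite !ge_min lexx.
have h0 := main e k e0 k0 k1 (etaP k keta).
have h1 : k * (lm * M) <= e * (lm * M) by rewrite ler_wpM2r.
have h2 : k * G <= e * G by rewrite ler_wpM2r.
have h4 : e * B = a / 2.
  by rewrite /e; field; rewrite gt_eqF.
move: h4; rewrite /B; clearbody e k; lra.
Qed.

End PointwiseEstimates.

Section Key.
Variables (R : realType) (n : nat).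
Implicit Types (p q f g u v : {mpoly R[n]}) (x : 'I_n -> R).
Hypothesis n2 : (2 <= n)%N.

Let onS x := \sum_j x j ^+ 2 = 1.

Lemma sph_eigen_mono i m : (i < m)%N -> (sph_eigen n i < sph_eigen n m)%N.
Proof. by rewrite /sph_eigen => im; nia. Qed.

(** Green's identity for phi(p) and phi(q), with a Landau kernel phi of parameter [k], bounds (lm -
    li) times the mean of (p q)^2 by errors that tend to 0 with [e] and [k]. *)
Lemma homog_harmonic_zero_sets_aux m i p q :
  p \is m.-homog -> q \is i.-homog -> harmonic p -> harmonic q -> (i < m)%N ->
  p != 0 -> q != 0 ->
  (forall x, onS x -> `|p.@[x]| <= 1 /\ `|q.@[x]| <= 1) ->
  (forall e : R, 0 < e -> exists2 eta : R, 0 < eta &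
     forall x, onS x -> `|p.@[x]| < eta -> `|q.@[x]| < e) ->
  False.
Proof.
move=> ph qh hp hq im p0 q0 bnd small.
have n0 : (0 < n)%N by lia.
pose lm : R := (sph_eigen n m)%:R; pose li : R := (sph_eigen n i)%:R.
have lm_li : 0 < lm - li by rewrite subr_gt0 ltr_nat sph_eigen_mono.
have li0 : 0 <= li by rewrite ler0n.
have lm0 : 0 < lm by lra.
have A0 : 0 < sphE ((p * q) * (p * q)).
  by apply: (sphE_sqr_gt0 n0 (dhomogM ph qh)); rewrite mulf_neq0.
pose A := sphE ((p * q) * (p * q)); rewrite -/A in A0.
pose M := sphE (1 : {mpoly R[n]}); pose G := sphE (sphGrad p).
have M0 : 0 <= M by apply: sphE_ge0 => // x _; rewrite meval1.
have G0 : 0 <= G by apply: sphE_ge0 => // x _; exact: sphGrad_ge0.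
have main (e k : R) : 0 < e -> 0 < k -> k < 1 ->
    (forall x, onS x -> `|p.@[x]| < k -> `|q.@[x]| < e) ->
    (lm - li) * A <= 2 * lm * k * M + e * lm * M + k * G.
  move=> e0 k0 k1 ke; have [phi phiP] := landau k0 k1.
  set phi1 := phi^`() in phiP; set phi2 := phi1^`() in phiP.
  have Lap f d : f \is d.-homog -> harmonic f -> sphLap (polyapp phi f) =
      - ((sph_eigen n d)%:R *: (polyapp phi1 f * f)) + polyapp phi2 f * sphGrad f.
    by move=> fd hf; rewrite sphLap_polyapp (sphLap_homog n2 hf fd) mulrN -scalerAr.
  (* [W] collects the eigenvalue terms and is at least (lm - li) |p q| up to O(k); [Tp] and [Tq] are
     the gradient terms. Only the sign of [Tq] is used, while [Tp] is small because q is small near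
     the zeros of p. *)
  pose W := lm *: (polyapp phi q * (polyapp phi1 p * p))
     - li *: (polyapp phi p * (polyapp phi1 q * q)).
  pose Tp := polyapp phi q * (polyapp phi2 p * sphGrad p).
  pose Tq := polyapp phi p * (polyapp phi2 q * sphGrad q).
  have WE : sphE W = sphE Tp - sphE Tq.
    rewrite /W sphEB !sphEZ.
    have := sphE_Lap_sym (polyapp phi q) (polyapp phi p).
    rewrite (Lap _ _ ph hp) (Lap _ _ qh hq) !mulrDr !mulrN -!scalerAr.
    have L (c : R) f g : sphE (- (c *: f) + g) = - (c * sphE f) + sphE g.
      by rewrite sphED -scaleNr sphEZ mulNr.
    rewrite (L _ _ Tp) (L _ _ Tq) -/lm -/li.
    by move: (sphE Tp) (sphE Tq) => t s; lra.
  have Tq0 : 0 <= sphE Tq.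
    apply: sphE_ge0 => // x xS; have [bp bq] := bnd x xS.
    rewrite !mevalM !meval_polyapp; have [_ _ h1 _ _] := phiP _ bp.
    have [h2 _ _ _ _] := phiP _ bq.
    by rewrite mulr_ge0 // mulr_ge0 // sphGrad_ge0.
  have W1 : sphE ((lm - li) *: ((p * q) * (p * q)) - (2 * lm * k) *: 1) <= sphE W.
    apply: sphE_le => // x xS; have [bp bq] := bnd x xS.
    rewrite /W !mevalB !mevalZ !mevalM !meval_polyapp meval1 mulr1.
    have [_ _ a0 a1 [a2 a3 a4]] := phiP _ bp.
    have [_ _ b0 b1 [b2 b3 b4]] := phiP _ bq.
    by apply: landau_lower_bound => //; [rewrite -subr_gt0|exact: ltW|exact: le_trans b2].
  have Tp1 : sphE Tp <= sphE (e *: (polyapp phi2 p * sphGrad p) + k *: sphGrad p).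
    apply: sphE_le => // x xS; have [bp bq] := bnd x xS.
    rewrite /Tp mevalD !mevalZ !mevalM !meval_polyapp.
    have [_ _ b0 b1 _] := phiP _ bq; have [a2 a2k _ _ _] := phiP _ bp.
    apply: (@landau_upper_bound _ _ _ p.@[x] q.@[x]) => //; try exact: ltW.
      exact: sphGrad_ge0.
    exact: ke.
  (* The mass of phi''(p) |grad p|^2 is bounded uniformly in [k]: a spherical Laplacian has mean 0,
     so this mass equals that of lm phi'(p) p. *)
  have Gam : sphE (polyapp phi2 p * sphGrad p) <= lm * M.
    have h1 : sphE (sphLap (polyapp phi p)) = 0.
      rewrite /sphLap sphE_sum big1 // => j _; rewrite sphE_sum big1 // => l _.
      exact: sphE_rotd.
    move: h1; rewrite (Lap _ _ ph hp) sphED -scaleNr sphEZ -/lm => h1.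
    have h2 : sphE (polyapp phi1 p * p) <= M.
      apply: sphE_le => // x xS; have [bp _] := bnd x xS.
      rewrite mevalM meval_polyapp meval1; have [_ _ _ _ [_ h _]] := phiP _ bp.
      exact: le_trans bp.
    have h3 := ler_wpM2l (ltW lm0) h2.
    by move/eqP: h1; rewrite mulNr addrC subr_eq0 => /eqP ->.
  have W2 : sphE ((lm - li) *: ((p * q) * (p * q)) - (2 * lm * k) *: 1)
      = (lm - li) * A - 2 * lm * k * M by rewrite sphEB !sphEZ.
  have Tp2 : sphE (e *: (polyapp phi2 p * sphGrad p) + k *: sphGrad p)
      = e * sphE (polyapp phi2 p * sphGrad p) + k * G by rewrite sphED !sphEZ.
  have eG := ler_wpM2l (ltW e0) Gam.
  move: W1 Tp1 eG Tq0; rewrite W2 WE Tp2.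
  move: (sphE Tp) (sphE Tq) (sphE (polyapp phi2 p * _)).
  by clear; move: ((lm - li) * A) => a tp tq g; lra.
apply: (@vanishing_error_contradiction _ lm ((lm - li) * A) M G
  (fun e k => forall x, onS x -> `|p.@[x]| < k -> `|q.@[x]| < e)) => //.
- by rewrite mulr_gt0.
- move=> e e0; have [eta eta0 etaP] := small e e0; exists eta => // k keta x xS px.
  by apply: etaP => //; exact: lt_le_trans keta.
Qed.

End Key.

(** * The l1 norm of coefficients, affine substitutions and homogeneous parts *)

Section Norm.
Variables (R : realType) (n : nat).
Implicit Types (p q f g : {mpoly R[n]}) (x y : 'I_n -> R).

Definition nrm p : R := \sum_(m <- msupp p) `|p@_m|.

Lemma nrm_ge0 p : 0 <= nrm p. Proof. by apply: sumr_ge0. Qed.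

Lemma nrmE D p : (msize p <= D)%N -> nrm p = \sum_(m : 'X_{1..n < D}) `|p@_m|.
Proof.
move=> le_D; pose I : subFinType _ := 'X_{1..n < D}.
rewrite /nrm (big_mksub I) ?msupp_uniq //=; last first.
  by move=> m /msize_mdeg_lt /leq_trans; apply.
by rewrite big_rmcond //= => i /memN_msupp_eq0 ->; rewrite normr0.
Qed.

Lemma nrm0 : nrm 0 = 0. Proof. by rewrite /nrm msupp0 big_nil. Qed.

Lemma nrm_coef p m : `|p@_m| <= nrm p.
Proof.
have [mp|mp] := boolP (m \in msupp p); last first.
  by rewrite (memN_msupp_eq0 mp) normr0 nrm_ge0.
by rewrite /nrm (big_rem m) //= lerDl sumr_ge0.
Qed.

Lemma nrm_eq0 p : nrm p = 0 -> p = 0.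
Proof.
move=> p0; apply/mpolyP => m; rewrite mcoeff0.
by apply/eqP; rewrite -normr_le0 -p0; exact: nrm_coef.
Qed.

Lemma nrm_gt0 p : p != 0 -> 0 < nrm p.
Proof.
by move=> p0; rewrite lt_def nrm_ge0 andbT; apply: contraNneq p0 => /nrm_eq0 ->.
Qed.

Lemma nrm_le c p q : 0 <= c -> (forall m, `|q@_m| <= c * `|p@_m|) ->
  nrm q <= c * nrm p.
Proof.
move=> c0 qp; pose D := maxn (msize p) (msize q).
rewrite (@nrmE D p) ?leq_maxl // (@nrmE D q) ?leq_maxr // mulr_sumr.
by apply: ler_sum => m _.
Qed.

Lemma nrmD p q : nrm (p + q) <= nrm p + nrm q.
Proof.
pose D := maxn (msize p) (msize q).
rewrite (@nrmE D p) ?leq_maxl // (@nrmE D q) ?leq_maxr // (@nrmE D).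
  by rewrite -big_split; apply: ler_sum => m _; rewrite mcoeffD ler_normD.
exact: msizeD_le.
Qed.

Lemma nrmZ c p : nrm (c *: p) <= `|c| * nrm p.
Proof. by apply: nrm_le => // m; rewrite mcoeffZ normrM. Qed.

Lemma nrmZE c p : nrm (c *: p) = `|c| * nrm p.
Proof.
have [->|c0] := eqVneq c 0; first by rewrite scale0r nrm0 normr0 mul0r.
apply/le_anti; rewrite nrmZ /= -ler_pdivlMl ?normr_gt0 //.
have := nrmZ c^-1 (c *: p); rewrite scalerA mulVf // scale1r.
by rewrite normfV.
Qed.

Lemma nrmN p : nrm (- p) = nrm p.
Proof. by rewrite -scaleN1r nrmZE normrN1 mul1r. Qed.

Lemma nrmB p q : nrm (p - q) <= nrm p + nrm q.
Proof. by rewrite -(nrmN q) nrmD. Qed.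

Lemma nrmBC p q : nrm (p - q) = nrm (q - p).
Proof. by rewrite -nrmN opprB. Qed.

Lemma nrm_sum (I : Type) (r : seq I) (P : pred I) (F : I -> {mpoly R[n]}) :
  nrm (\sum_(i <- r | P i) F i) <= \sum_(i <- r | P i) nrm (F i).
Proof.
elim/big_rec2: _ => [|i a b _ le]; first by rewrite nrm0.
by apply: le_trans (nrmD _ _) _; rewrite lerD2l.
Qed.

Lemma nrmXm m : nrm 'X_[m] = 1.
Proof. by rewrite /nrm msuppX big_seq1 mcoeffX eqxx normr1. Qed.

Lemma nrmC c : nrm c%:MP = `|c|.
Proof. by rewrite -[c%:MP]mulr1 mul_mpolyC nrmZE -mpolyX0 nrmXm mulr1. Qed.

Lemma nrmM p q : nrm (p * q) <= nrm p * nrm q.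
Proof.
have Xq m : nrm ('X_[m] * q) <= nrm q.
  rewrite {1}(mpolyE q) mulr_sumr (le_trans (nrm_sum _ _ _)) //.
  by apply: ler_sum => k _; rewrite -scalerAr -mpolyXD nrmZE nrmXm mulr1.
rewrite {1}(mpolyE p) mulr_suml (le_trans (nrm_sum _ _ _)) // {2}/nrm mulr_suml.
by apply: ler_sum => m _; rewrite -scalerAl nrmZE ler_wpM2l.
Qed.

Lemma nrm_prod (I : Type) (r : seq I) (F : I -> {mpoly R[n]}) :
  nrm (\prod_(i <- r) F i) <= \prod_(i <- r) nrm (F i).
Proof.
elim/big_rec2: _ => [|i a b _ le]; first by rewrite -mpolyX0 nrmXm.
by apply: le_trans (nrmM _ _) _; rewrite ler_wpM2l ?nrm_ge0.
Qed.

Lemma nrmXn p k : nrm (p ^+ k) <= nrm p ^+ k.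
Proof.
elim: k => [|k IH]; first by rewrite !expr0 -mpolyX0 nrmXm.
by rewrite !exprS (le_trans (nrmM _ _)) // ler_wpM2l ?nrm_ge0.
Qed.

Lemma meval_nrm p x : (forall i, `|x i| <= 1) -> `|p.@[x]| <= nrm p.
Proof.
move=> x1; rewrite mevalE (le_trans (ler_norm_sum _ _ _)) //.
apply: ler_sum => m _; rewrite normrM -[leRHS]mulr1 ler_wpM2l //.
rewrite normr_prod; apply: prodr_ile1 => i _.
by rewrite normrX exprn_ge0 //= exprn_ile1.
Qed.

Lemma mpoly_eval_inj p q : (forall x, p.@[x] = q.@[x]) -> p = q.
Proof.
move=> pq; apply/eqP; rewrite -subr_eq0; apply/eqP/mpoly_meval0 => x.
by rewrite mevalB pq subrr.
Qed.

Lemma mpoly_ring_ind (P : {mpoly R[n]} -> Prop) :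
  (forall c, P c%:MP) -> (forall i, P 'X_i) ->
  (forall p q, P p -> P q -> P (p + q)) -> (forall p q, P p -> P q -> P (p * q)) ->
  forall p, P p.
Proof.
move=> PC PX PD PM.
have P1 : P 1 by rewrite -(mpolyC1).
have PXn p k : P p -> P (p ^+ k).
  by move=> Pp; elim: k => [|k IH]; rewrite ?expr0 // exprS; exact: PM.
elim/mpolyind => [|c m p _ _ Pp]; first by rewrite -(mpolyC0 n).
apply: PD => //; rewrite -mul_mpolyC; apply: (PM) => //.
by rewrite mpolyXE_id; elim/big_rec: _ => // i q _ Pq; apply: (PM) => //; exact: PXn.
Qed.

Lemma msizeM_leS a b p q :
  (msize p <= a.+1)%N -> (msize q <= b.+1)%N -> (msize (p * q) <= (a + b).+1)%N.
Proof.
move=> pa qb; have [->|p0] := eqVneq p 0; first by rewrite mul0r mmeasure0.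
have [->|q0] := eqVneq q 0; first by rewrite mulr0 mmeasure0.
by rewrite msizeM // -subn1 leq_subLR add1n -addSn -addnS leq_add.
Qed.

(** * Affine substitutions *)

Definition aff x (r : R) p : {mpoly R[n]} :=
  p \mPo [tuple (x i)%:MP + r *: 'X_i | i < n].

Lemma meval_aff x r p y : (aff x r p).@[y] = p.@[fun i => x i + r * y i].
Proof.
rewrite /aff comp_mpoly_meval; apply: meval_eq => i.
by rewrite tnth_mktuple mevalD mevalC mevalZ mevalXU.
Qed.

Lemma affD x r p q : aff x r (p + q) = aff x r p + aff x r q.
Proof. exact: comp_mpolyD. Qed.
Lemma affB x r p q : aff x r (p - q) = aff x r p - aff x r q.
Proof. exact: comp_mpolyB. Qed.
Lemma aff0 x r : aff x r 0 = 0.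
Proof. exact: comp_mpoly0. Qed.
Lemma affZ x r c p : aff x r (c *: p) = c *: aff x r p.
Proof. exact: comp_mpolyZ. Qed.
Lemma affM x r p q : aff x r (p * q) = aff x r p * aff x r q.
Proof. by apply: mpoly_eval_inj => y; rewrite mevalM !meval_aff mevalM. Qed.
Lemma affC x r c : aff x r c%:MP = c%:MP.
Proof. exact: comp_mpolyC. Qed.

Lemma affX x r i : aff x r 'X_i = (x i)%:MP + r *: 'X_i.
Proof.
apply: mpoly_eval_inj => y.
by rewrite meval_aff mevalD mevalC mevalZ !mevalXU.
Qed.

Lemma aff_comp x r y s p :
  aff y s (aff x r p) = aff (fun i => x i + r * y i) (r * s) p.
Proof.
apply: mpoly_eval_inj => z; rewrite !meval_aff; apply: meval_eq => i; ring.
Qed.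

Lemma aff_id p : aff (fun=> 0) 1 p = p.
Proof.
by apply: mpoly_eval_inj => z; rewrite !meval_aff; apply: meval_eq => i; ring.
Qed.

Lemma eq_aff x y r p : x =1 y -> aff x r p = aff y r p.
Proof.
by move=> xy; apply: mpoly_eval_inj => z; rewrite !meval_aff; apply: meval_eq => i; rewrite xy.
Qed.

Lemma affK x r p : r != 0 -> aff (fun i => - (x i / r)) r^-1 (aff x r p) = p.
Proof.
move=> r0; rewrite aff_comp -[RHS]aff_id mulfV //; apply: eq_aff => i; field.
by [].
Qed.

Lemma aff_eq0 x r p : r != 0 -> (aff x r p == 0) = (p == 0).
Proof.
move=> r0; apply/eqP/eqP => [h|->]; last exact: aff0.
by rewrite -(affK x p r0) h aff0.
Qed.

Lemma mderiv_aff x r p i : (aff x r p)^`M(i) = r *: aff x r p^`M(i).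
Proof.
elim/mpoly_ring_ind: p => [c|j|p q hp hq|p q hp hq].
- by rewrite affC !mderivC aff0 scaler0.
- rewrite affX mderivD mderivC add0r mderivZ; congr (_ *: _).
  rewrite !mderivX affZ mnm1E; case: eqP => [->|_]; last by rewrite !scale0r.
  have -> : (U_(i) - U_(i) = 0 :> 'X_{1..n})%MM.
    by apply/mnmP => k; rewrite mnmBE subnn mnm0E.
  by rewrite mpolyX0 -mpolyC1 affC.
- by rewrite affD !mderivD hp hq affD scalerDr.
- by rewrite affM !mderivM hp hq affD !affM scalerDr scalerAl scalerAr.
Qed.

Lemma harmonic_aff x r p : harmonic p -> harmonic (aff x r p).
Proof.
move=> hp; rewrite /harmonic.
under eq_bigr => i _ do rewrite mderiv_aff mderivZ mderiv_aff scalerA.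
rewrite -scaler_sumr; have -> : \sum_i aff x r (p^`M(i))^`M(i)
    = aff x r (\sum_(i < n) (p^`M(i))^`M(i)).
  by elim/big_rec2: _ => [|i a b _ ->]; rewrite ?aff0 ?affD.
by rewrite hp aff0 scaler0.
Qed.

Lemma harmonicZ c p : harmonic p -> harmonic (c *: p).
Proof.
move=> hp; rewrite /harmonic; under eq_bigr => i _ do rewrite !mderivZ.
by rewrite -scaler_sumr hp scaler0.
Qed.

Lemma aff_monomE x r m :
  aff x r 'X_[m] = \prod_(i < n) ((x i)%:MP + r *: 'X_i) ^+ m i.
Proof.
rewrite /aff comp_mpolyX; apply: eq_bigr => i _.
by rewrite tnth_mktuple.
Qed.

Lemma affE x r p : aff x r p = \sum_(m <- msupp p) p@_m *: aff x r 'X_[m].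
Proof.
rewrite {1}(mpolyE p); elim: (msupp p) => [|m s IH].
  by rewrite !big_nil aff0.
by rewrite !big_cons affD affZ IH.
Qed.

Lemma msize_aff x r p D : (msize p <= D)%N -> (msize (aff x r p) <= D)%N.
Proof.
move=> pD; rewrite affE (leq_trans (msize_sum _ _ _)) //.
have key m : (msize (aff x r 'X_[m]) <= (mdeg m).+1)%N.
  rewrite aff_monomE mdegE.
  pose Q (q : {mpoly R[n]}) (k : nat) := (msize q <= k.+1)%N.
  have Q1 : Q 1 0%N by rewrite /Q msize1.
  have QX i k : Q (((x i)%:MP + r *: 'X_i) ^+ k) k.
    elim: k => [|k IH]; first by rewrite expr0.
    rewrite exprS -add1n; apply: msizeM_leS IH.
    rewrite (leq_trans (msizeD_le _ _)) // geq_max msizeC.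
    rewrite (leq_trans (leq_b1 _)) //= (leq_trans (msizeZ_le _ _)) //.
    by rewrite msizeX mdeg1.
  rewrite -/(Q _ _).
  apply: (big_ind2 Q) => [//|a b a' b' h1 h2|i _]; last exact: QX.
  exact: msizeM_leS.
rewrite big_seq; elim/big_ind: _ => // [a b aD bD|m mp].
  by rewrite geq_max aD bD.
apply: leq_trans (msizeZ_le _ _) (leq_trans (key m) _).
exact: leq_trans (msize_mdeg_lt mp) pD.
Qed.

(** The norm is submultiplicative, and a monomial of degree at most [k] becomes a product of at most
    [k] factors of norm at most [B]. *)
Lemma nrm_aff x r p B k : 1 <= B -> (forall i, `|x i| + `|r| <= B) ->
  (msize p <= k.+1)%N -> nrm (aff x r p) <= B ^+ k * nrm p.
Proof.
move=> B1 xB pk; rewrite affE (le_trans (nrm_sum _ _ _)) // /nrm mulr_sumr.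
rewrite big_seq [leRHS]big_seq; apply: ler_sum => m mp.
rewrite -/(nrm _) nrmZE mulrC ler_wpM2r // aff_monomE (le_trans (nrm_prod _ _)) //.
have B0 : 0 <= B by exact: le_trans B1.
have mk : (mdeg m <= k)%N by have := leq_trans (msize_mdeg_lt mp) pk; rewrite ltnS.
apply: (@le_trans _ _ (B ^+ mdeg m)); last by rewrite ler_weXn2l.
rewrite mdegE -prodrXr; apply: ler_prod => i _; rewrite nrm_ge0 /=.
apply: le_trans (nrmXn _ _) _; rewrite lerXn2r ?nnegrE ?nrm_ge0 //.
apply: le_trans (nrmD _ _) _; rewrite nrmC nrmZE nrmXm mulr1; exact: xB.
Qed.

(** * Parts of given degrees, and rescaling at the origin *)

Definition dpart (S : pred nat) p : {mpoly R[n]} :=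
  \sum_(m <- msupp p | S (mdeg m)) p@_m *: 'X_[m].

Lemma mcoeff_dpart S p m : (dpart S p)@_m = if S (mdeg m) then p@_m else 0.
Proof.
rewrite /dpart raddf_sum /=.
under eq_bigr => k _ do rewrite mcoeffZ mcoeffX.
have [mp|mp] := boolP (m \in msupp p); last first.
  rewrite (memN_msupp_eq0 mp) if_same big_seq_cond big1 // => k /andP[kp _].
  by case: eqP kp mp => [->->//|]; rewrite mulr0.
rewrite big_mkcond (bigD1_seq m) //= ?msupp_uniq // eqxx mulr1 big1 ?addr0 // => k km.
by rewrite (negPf km) mulr0 if_same.
Qed.

Lemma mcoeff_lap p m : (\sum_(i < n) (p^`M(i))^`M(i))@_m =
  \sum_(i < n) p@_(m + U_(i) + U_(i)) *+ ((m + U_(i))%MM i).+1 *+ (m i).+1.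
Proof.
by rewrite raddf_sum /=; apply: eq_bigr => i _; rewrite !mcoeff_deriv.
Qed.

(** The Laplacian lowers every degree by exactly two, hence acts on each degree separately. *)
Lemma harmonic_dpart S p : harmonic p -> harmonic (dpart S p).
Proof.
move=> hp; apply/mpolyP => m; rewrite mcoeff0 mcoeff_lap.
under eq_bigr => i _ do rewrite mcoeff_dpart !mdegD !mdeg1 -addnA.
case: (S _); last by rewrite big1 // => i _; rewrite !mul0rn.
by rewrite -mcoeff_lap hp mcoeff0.
Qed.

Lemma nrm_dpart S p : nrm (dpart S p) <= nrm p.
Proof.
rewrite -[leRHS]mul1r; apply: nrm_le => // m; rewrite mul1r mcoeff_dpart.
by case: ifP => // _; rewrite normr0.
Qed.

Lemma dpart_homog d p : dpart (pred1 d) p \is d.-homog.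
Proof.
apply/dhomogP => m; rewrite mcoeff_msupp mcoeff_dpart /=.
by have [->|_] := eqVneq (mdeg m) d; rewrite ?eqxx.
Qed.

Lemma msize_leP p k : (forall m, p@_m != 0 -> (mdeg m < k)%N) <-> (msize p <= k)%N.
Proof.
split=> [h|h m pm]; last first.
  by apply: leq_trans h; apply: msize_mdeg_lt; rewrite mcoeff_msupp.
have [->|p0] := eqVneq p 0; first by rewrite mmeasure0.
by rewrite -mlead_deg //; apply: h; rewrite mleadc_eq0.
Qed.

Lemma msize_dpart_low k p : (msize (dpart (fun d => d <= k)%N p) <= k.+1)%N.
Proof.
by apply/msize_leP => m; rewrite mcoeff_dpart; case: ifP => //; rewrite eqxx.
Qed.

Lemma mcoeff_aff0 s p m : (aff (fun=> 0) s p)@_m = s ^+ mdeg m * p@_m.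
Proof.
rewrite affE [in RHS](mpolyE p) !raddf_sum mulr_sumr /=; apply: eq_bigr => k _.
rewrite !mcoeffZ mulrCA; congr (_ * _).
have -> : aff (fun=> 0) s 'X_[k] = s ^+ mdeg k *: 'X_[k].
  apply: mpoly_eval_inj => y; rewrite meval_aff mevalZ !mevalX mdegE -prodrXr.
  by rewrite -big_split; apply: eq_bigr => i _; rewrite add0r exprMn.
rewrite mcoeffZ mcoeffX; case: eqP => [->//|_]; by rewrite !mulr0.
Qed.

Lemma lowest_degree p : p != 0 -> exists d,
  dpart (pred1 d) p != 0 /\ forall m, p@_m != 0 -> (d <= mdeg m)%N.
Proof.
move=> p0; pose P d := has (fun m => mdeg m == d) (msupp p).
have exP : exists d, P d.
  by exists (mdeg (mlead p)); apply/hasP; exists (mlead p); rewrite ?mlead_supp.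
case: (ex_minnP exP) => d /hasP[m mp /eqP md] dmin; exists d; split.
  apply: contraTneq mp => h; rewrite mcoeff_msupp negbK.
  have : (dpart (pred1 d) p)@_m = 0 by rewrite h mcoeff0.
  by rewrite mcoeff_dpart /= md eqxx => ->.
by move=> k; rewrite -mcoeff_msupp => kp; apply: dmin; apply/hasP; exists k.
Qed.

(** After division by s^d the terms of degree [d] are unchanged, and those of higher degree carry at
    least one factor [s]. *)
Lemma blowup_nrm d p s : 0 < s -> s <= 1 ->
  (forall m, p@_m != 0 -> (d <= mdeg m)%N) ->
  nrm (s ^- d *: aff (fun=> 0) s p - dpart (pred1 d) p) <= s * nrm p.
Proof.
move=> s0 s1 dmin; have s0' := ltW s0; apply: nrm_le; first exact: ltW.
move=> m; rewrite mcoeffB mcoeffZ mcoeff_aff0 mcoeff_dpart /=.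
have [->|pm] := eqVneq p@_m 0; first by rewrite if_same !mulr0 subr0 normr0 mulr0.
have dm := dmin m pm.
have sE : s ^- d * s ^+ mdeg m = s ^+ (mdeg m - d).
  by rewrite -{1}(subnK dm) exprD mulrCA mulVf ?mulr1 // expf_neq0 // gt_eqF.
rewrite mulrA sE.
case: eqP => [->|/eqP md]; first by rewrite subnn mul1r subrr normr0 mulr_ge0 // ltW.
rewrite subr0 normrM ler_wpM2r // ger0_norm ?exprn_ge0 //.
have : (0 < mdeg m - d)%N by rewrite subn_gt0 ltn_neqAle eq_sym md.
case: (_ - _)%N => // a _; rewrite exprS -[leRHS]mulr1 ler_wpM2l //.
by rewrite exprn_ile1 // ltW.
Qed.

Lemma nrm_aff0_low k s p : 0 < s -> s <= 1 -> (msize p <= k.+1)%N ->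
  s ^+ k * nrm p <= nrm (aff (fun=> 0) s p).
Proof.
move=> s0 s1 pk; have s0' := ltW s0.
rewrite mulrC -ler_pdivlMr ?exprn_gt0 // mulrC.
apply: nrm_le; first by rewrite invr_ge0 exprn_ge0 // ltW.
move=> m; rewrite mcoeff_aff0 normrM mulrA -[leLHS]mul1r.
have [->|pm] := eqVneq p@_m 0; first by rewrite normr0 !mulr0.
rewrite ler_wpM2r // ger0_norm ?exprn_ge0 // mulrC ler_pdivlMr ?exprn_gt0 // mul1r.
have /msize_leP/(_ m pm) := pk; rewrite ltnS => mk.
by rewrite ler_wiXn2l // ltW.
Qed.

Lemma nrm_aff0_high k s p : 0 < s -> s <= 1 ->
  nrm (aff (fun=> 0) s p - aff (fun=> 0) s (dpart (fun d => d <= k)%N p))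
    <= s ^+ k.+1 * nrm p.
Proof.
move=> s0 s1; have s0' := ltW s0; apply: nrm_le; first by rewrite exprn_ge0 // ltW.
move=> m; rewrite mcoeffB !mcoeff_aff0 mcoeff_dpart; case: leqP => [_|km].
  by rewrite subrr normr0 mulr_ge0 // exprn_ge0 // ltW.
rewrite mulr0 subr0 normrM ler_wpM2r // ger0_norm ?exprn_ge0 //.
by rewrite ler_wiXn2l // ltW.
Qed.

End Norm.

(** * Sequential compactness and sign changes of harmonic polynomials *)

Section Cluster.
Variable R : realType.
Local Open Scope classical_set_scope.

(** Bolzano-Weierstrass in finite dimension. Of the index map only [j <= f j] is asked, which
    suffices to carry over conditions that hold eventually. *)
Lemma cluster_family (I : finType) (u : nat -> I -> R) (B : R) :
  (forall j i, `|u j i| <= B) ->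
  exists (l : I -> R) (f : nat -> nat), (forall j, (j <= f j)%N) /\
    forall j i, `|u (f j) i - l i| < j.+1%:R^-1.
Proof.
move=> uB; pose v j : 'rV[R]_#|I| := \row_(i < #|I|) u j (enum_val i).
pose K := [set w : 'rV[R]_#|I| | forall i, w ord0 i \in `[- B, B]%R].
have cK : compact K.
  apply: (@rV_compact _ _ (fun=> [set` `[- B, B]%R])) => _; exact: segment_compact.
have [|w [_ wcl]] := cK (v @ \oo) _.
  by exists 0%N => // j _ i; rewrite mxE in_itv /= -ler_norml.
have near (j : nat) : exists k, (j <= k)%N /\
    forall i, `|u k i - w ord0 (enum_rank i)| < j.+1%:R^-1.
  have FA : (v @ \oo) [set v k | k in [set k | (j <= k)%N]].
    by exists j => // k jk; exists k.
  have e0 : 0 < j.+1%:R^-1 :> R by rewrite invr_gt0.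
  have [_ [[k jk <-] kb]] := wcl _ _ FA (nbhsx_ballx w _ e0).
  exists k; split => // i; have [_ /(_ ord0 (enum_rank i))] := kb.
  by rewrite /ball /= mxE enum_rankK distrC.
have [f fP] := choice near.
by exists (fun i => w ord0 (enum_rank i)), f; split=> [j|j i]; have [] := fP j.
Qed.

End Cluster.

Section Analysis.
Variables (R : realType) (n : nat).
Implicit Types (p q f g : {mpoly R[n]}) (x y a b : 'I_n -> R).

Lemma inv_natS_lt (e : R) : 0 < e -> exists J, forall j, (J <= j)%N -> j.+1%:R^-1 < e.
Proof.
move=> e0; exists (Num.truncn e^-1) => j Jj.
rewrite invf_plt ?posrE //; apply: lt_le_trans (truncnS_gt _) _.
by rewrite ler_nat.
Qed.

Lemma mpoly_cluster D (P : nat -> {mpoly R[n]}) (B : R) :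
  (forall j, msize (P j) <= D)%N -> (forall j, nrm (P j) <= B) ->
  exists (P0 : {mpoly R[n]}) (f : nat -> nat),
  [/\ (msize P0 <= D)%N, forall j, (j <= f j)%N &
   forall e, 0 < e -> exists J, forall j, (J <= j)%N -> nrm (P (f j) - P0) < e].
Proof.
move=> PD PB; pose I := 'X_{1..n < D}.
have [|l [f [fj fl]]] := @cluster_family _ I (fun j (m : I) => (P j)@_m) B.
  by move=> j m; exact: le_trans (nrm_coef _ _) (PB j).
pose P0 : {mpoly R[n]} := \sum_(m : I) l m *: 'X_[m].
have P0m (m : I) : P0@_m = l m.
  rewrite /P0 raddf_sum /= (bigD1 m) //= mcoeffZ mcoeffX eqxx mulr1 big1 ?addr0 //.
  move=> k km; rewrite mcoeffZ mcoeffX.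
  by rewrite (_ : _ == _ = false) ?mulr0 //; apply/negbTE.
have P0D : (msize P0 <= D)%N.
  apply/msize_leP => m; apply: contraR; rewrite -leqNgt => Dm.
  rewrite /P0 raddf_sum /= big1 // => k _; rewrite mcoeffZ mcoeffX.
  case: eqP => [km|_]; last by rewrite mulr0.
  by have := bmdeg k; rewrite km ltnNge Dm.
exists P0, f; split=> // e e0.
pose N := #|{: I}|.+1; have N0 : 0 < N%:R :> R by rewrite ltr0n.
have [J JP] := inv_natS_lt (divr_gt0 e0 N0).
exists J => j /JP jJ; rewrite (@nrmE _ _ D); last first.
  by rewrite (leq_trans (msizeD_le _ _)) // geq_max PD msizeN P0D.
apply: (@le_lt_trans _ _ (\sum_(m : I) e / N%:R)).
  apply: ler_sum => m _; rewrite mcoeffB P0m; apply/ltW.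
  exact: lt_trans (fl j m) jJ.
rewrite sumr_const -[ltLHS]mulr_natr mulrAC ltr_pdivrMr // ltr_pM2l // ltr_nat.
by rewrite /N.
Qed.

Lemma meval_origin p : p.@[fun=> 0] = p@_0%MM.
Proof.
elim/mpoly_ring_ind: p => [c|i|p q hp hq|p q hp hq].
- by rewrite mevalC mcoeffC eqxx mulr1.
- by rewrite mevalXU mcoeffX mnm1_eq0.
- by rewrite mevalD mcoeffD hp hq.
- by rewrite mevalM hp hq rmorphM.
Qed.

Lemma meval_scale p c x : p.@[fun i => c * x i] = (aff (fun=> 0) c p).@[x].
Proof. by rewrite meval_aff; apply: meval_eq => i; rewrite add0r. Qed.

Lemma aff0_homog d p c : p \is d.-homog -> aff (fun=> 0) c p = c ^+ d *: p.
Proof.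
move=> /dhomogP pd; apply/mpolyP => m; rewrite mcoeff_aff0 mcoeffZ.
have [mp|mp] := boolP (m \in msupp p); last by rewrite (memN_msupp_eq0 mp) !mulr0.
by have /= -> := pd _ mp.
Qed.

Lemma meval_homog d p c x : p \is d.-homog -> p.@[fun i => c * x i] = c ^+ d * p.@[x].
Proof. by move=> pd; rewrite meval_scale (aff0_homog _ pd) mevalZ. Qed.

(** Write x = s w with w in the unit cube: without its constant term the polynomial rescaled by [s]
    has norm at most [s * nrm p]. *)
Lemma meval_near0 p (s : R) x : 0 < s -> s <= 1 -> (forall i, `|x i| <= s) ->
  `|p.@[x] - p.@[fun=> 0]| <= 2 * s * nrm p.
Proof.
move=> s0 s1 xs; pose w i := x i / s.
have w1 i : `|w i| <= 1.
  by rewrite normrM normfV (gtr0_norm s0) ler_pdivrMr // mul1r.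
pose D := aff (fun=> 0) s p - aff (fun=> 0) s (dpart (fun d => d <= 0)%N p).
have DE y : D.@[y] = p.@[fun i => s * y i] - p@_0%MM.
  rewrite mevalB -!meval_scale; congr (_ - _).
  rewrite (msize1_polyC (msize_dpart_low 0 p)) mevalC mcoeff_dpart mdeg0 //.
have Ds : nrm D <= s * nrm p by exact: nrm_aff0_high.
have -> : p.@[x] - p.@[fun=> 0] = D.@[w] - D.@[fun=> 0].
  have e1 : p.@[fun i => s * w i] = p.@[x].
    by apply: meval_eq => i; rewrite /w mulrC divfK ?gt_eqF.
  have e2 : p.@[fun i => s * 0] = p.@[fun=> 0].
    by apply: meval_eq => i; rewrite mulr0.
  by rewrite !DE e1 e2; ring.
apply: le_trans (ler_normB _ _) _.
have h1 := meval_nrm D w1; have h2 : `|D.@[fun=> 0]| <= nrm D.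
  by apply: meval_nrm => i; rewrite normr0.
lra.
Qed.

Lemma meval_cont p a (e : R) : 0 < e ->
  exists2 s : R, 0 < s & forall y, (forall i, `|y i - a i| <= s) -> `|p.@[y] - p.@[a]| < e.
Proof.
move=> e0; pose q := aff a 1 p; pose N := 2 * nrm q + 1.
have N0 : 0 < N by have := nrm_ge0 q; rewrite /N; lra.
pose s := Num.min 1 (e / (2 * N)).
have s0 : 0 < s by rewrite lt_min ltr01 divr_gt0 // mulr_gt0.
exists s => // y ya.
have := @meval_near0 q s (fun i => y i - a i) s0 _ ya.
rewrite ge_min lexx => /(_ isT); rewrite !meval_aff.
have -> : p.@[fun i => a i + 1 * (y i - a i)] = p.@[y].
  by apply: meval_eq => i; ring.
have -> : p.@[fun i => a i + 1 * 0] = p.@[a] by apply: meval_eq => i; ring.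
move/le_lt_trans; apply.
have : s <= e / (2 * N) by rewrite ge_min lexx orbT.
rewrite ler_pdivlMr ?mulr_gt0 // /N; have := nrm_ge0 q; nra.
Qed.

(* Polynomials are evaluated at functions; [enorm v] is [en (v 0)]. *)
Definition en x : R := Num.sqrt (\sum_i x i ^+ 2).

Lemma en_sum_ge0 x : 0 <= \sum_i x i ^+ 2.
Proof. by apply: sumr_ge0 => i _; exact: sqr_ge0. Qed.

Lemma en_ge0 x : 0 <= en x. Proof. exact: sqrtr_ge0. Qed.

Lemma en_coord x i : `|x i| <= en x.
Proof.
rewrite -sqrtr_sqr ler_sqrt ?en_sum_ge0 // (bigD1 i) //= lerDl.
by apply: sumr_ge0 => j _; exact: sqr_ge0.
Qed.

Lemma enZ c x : en (fun i => c * x i) = `|c| * en x.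
Proof.
rewrite /en; under eq_bigr => i _ do rewrite exprMn.
by rewrite -mulr_sumr sqrtrM ?sqr_ge0 // sqrtr_sqr.
Qed.

Lemma eq_en x y : x =1 y -> en x = en y.
Proof. by move=> xy; rewrite /en; under eq_bigr => i _ do rewrite xy. Qed.

Lemma en_lt1 x : (en x < 1) = (\sum_i x i ^+ 2 < 1).
Proof. by rewrite -[1 in LHS]sqrtr1 ltr_sqrt. Qed.

Lemma en_box x : (forall i, `|x i| <= n.+1%:R^-1) -> en x < 1.
Proof.
move=> xb; rewrite en_lt1.
have n0 : 0 < n.+1%:R :> R by rewrite ltr0n.
apply: (@le_lt_trans _ _ (\sum_(i < n) n.+1%:R^-1 ^+ 2)).
  apply: ler_sum => i _; rewrite -real_normK ?num_real // lerXn2r ?nnegrE //.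
  by rewrite invr_ge0 ltW.
rewrite sumr_const card_ord -[ltLHS]mulr_natl exprVn ltr_pdivrMr ?exprn_gt0 // mul1r.
by rewrite -natrX ltr_nat; nia.
Qed.

Lemma en_open a : en a < 1 ->
  exists2 s : R, 0 < s & forall y, (forall i, `|y i - a i| <= s) -> en y < 1.
Proof.
rewrite en_lt1 -meval_sqnorm => a1.
have [|s s0 sP] := @meval_cont (sqnorm R n) a (1 - (sqnorm R n).@[a]).
  by rewrite subr_gt0.
by exists s => // y /sP /(le_lt_trans (ler_norm _)); rewrite en_lt1 -meval_sqnorm; lra.
Qed.

(** * Zeros on segments and sign changes *)

Lemma mpoly_line p a b : exists g : {poly R},
  forall t, g.[t] = p.@[fun i => a i + t * (b i - a i)].
Proof.
elim/mpoly_ring_ind: p => [c|i|p q [g gP] [h hP]|p q [g gP] [h hP]].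
- by exists c%:P => t; rewrite hornerC mevalC.
- exists ((a i)%:P + (b i - a i)%:P * 'X) => t.
  by rewrite hornerD hornerM hornerX !hornerC mevalXU mulrC.
- by exists (g + h) => t; rewrite hornerD mevalD gP hP.
- by exists (g * h) => t; rewrite hornerM mevalM gP hP.
Qed.

Lemma mpoly_ivt p a b : p.@[a] * p.@[b] <= 0 ->
  exists2 t : R, 0 <= t <= 1 & p.@[fun i => a i + t * (b i - a i)] = 0.
Proof.
move=> ab; have [g gP] := mpoly_line p a b.
have [||t t01 /rootP gt] := @polyrcf.poly_ivt _ g 0 1; first exact: ler01.
  rewrite !gP.
  have -> : p.@[fun i => a i + 0 * (b i - a i)] = p.@[a] by apply: meval_eq => i; ring.
  suff -> : p.@[fun i => a i + 1 * (b i - a i)] = p.@[b] by [].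
  by apply: meval_eq => i; ring.
by exists t; rewrite ?gP // in gt *; rewrite in_itv in t01.
Qed.

(** The spherical Laplacian of [p] has mean 0 and is a nonzero multiple of [p]. *)
Lemma gaussE_homog_harmonic d p : (2 <= n)%N -> (0 < d)%N ->
  p \is d.-homog -> harmonic p -> gaussE p = 0.
Proof.
move=> n2 d0 pd hp; have n0 : (0 < n)%N by lia.
have : sphE (sphLap p) = 0.
  rewrite /sphLap sphE_sum big1 // => j _; rewrite sphE_sum big1 // => l _.
  exact: sphE_rotd.
rewrite (sphLap_homog n2 hp pd) -scaleNr sphEZ (sphE_homog pd) => /eqP.
rewrite mulf_eq0 oppr_eq0 pnatr_eq0 mulf_eq0 invr_eq0 (gt_eqF (sphc_gt0 _ _ n0)) orbF.
by case/orP => [|/eqP//]; rewrite /sph_eigen => /eqP; nia.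
Qed.

(** A nonzero polynomial that is nowhere positive has negative Gaussian mean, whereas this mean is
    0. *)
Lemma homog_harmonic_pos d p : (2 <= n)%N -> (0 < d)%N ->
  p \is d.-homog -> harmonic p -> p != 0 -> exists x, 0 < p.@[x].
Proof.
move=> n2 d0 pd hp p0; apply: contrapT => /forallNP h.
have p_le0 x : 0 <= (- p).@[x] by rewrite mevalN oppr_ge0 leNgt; apply/negP; exact: h.
have [x px] : exists x, p.@[x] != 0.
  apply: contrapT => /forallNP h'; case/eqP: p0; apply: mpoly_meval0 => x.
  by apply/eqP/negPn/negP; exact: h'.
have px0 : 0 < (- p).@[x].
  by rewrite lt_def p_le0 mevalN oppr_eq0 px.
have := gaussE_gt0 p_le0 px0.
rewrite /gaussE -scaleN1r mlinZ -/(gaussE p) (gaussE_homog_harmonic n2 d0 pd hp).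
by rewrite mulr0 ltxx.
Qed.

(** Blow-up at [a]: the lowest homogeneous part is harmonic of positive degree, so it is positive
    somewhere, and at small scale it dominates. *)
Lemma harmonic_sign_change p a (eta : R) : (2 <= n)%N -> harmonic p -> p != 0 ->
  p.@[a] = 0 -> 0 < eta ->
  exists2 b, forall i, `|b i - a i| <= eta & 0 < p.@[b].
Proof.
move=> n2 hp p0 pa eta0; pose q := aff a 1 p.
have q0 : q != 0 by rewrite aff_eq0 ?oner_neq0.
have hq : harmonic q by exact: harmonic_aff.
have [d [qd0 dmin]] := lowest_degree q0.
have qd := dpart_homog d q; have hqd := harmonic_dpart (pred1 d) hq.
have q00 : q@_0%MM = 0.
  by rewrite -meval_origin meval_aff -[RHS]pa; apply: meval_eq => i; ring.
have d0 : (0 < d)%N.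
  rewrite lt0n; apply: contra_neqN qd0 => /eqP d0; apply/mpolyP => m.
  rewrite mcoeff0 mcoeff_dpart /= d0 mdeg_eq0; case: eqP => [->|//]; exact: q00.
have [x0 x0P] := homog_harmonic_pos n2 d0 qd hqd qd0.
pose c := (1 + en x0)^-1.
have c0 : 0 < c by rewrite invr_gt0; have := en_ge0 x0; lra.
pose x i := c * x0 i.
have x1 i : `|x i| <= 1.
  rewrite /x normrM (gtr0_norm c0) /c ler_pdivrMl; last by have := en_ge0 x0; lra.
  by have := en_coord x0 i; lra.
have xP : 0 < (dpart (pred1 d) q).@[x].
  by rewrite (meval_homog _ _ qd) mulr_gt0 // exprn_gt0.
set v := (dpart _ q).@[x] in xP.
pose N := nrm q + 1; have N0 : 0 < N by have := nrm_ge0 q; rewrite /N; lra.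
(* The blow-up error [s * nrm q] must stay below the value [v] of the homogeneous part. *)
pose s := Num.min (Num.min 1 eta) (v / (2 * N)).
have s0 : 0 < s by rewrite !lt_min ltr01 eta0 divr_gt0 // mulr_gt0.
have [s1 seta sv] : [/\ s <= 1, s <= eta & s <= v / (2 * N)].
  by rewrite !ge_min !lexx !orbT.
exists (fun i => a i + s * x i).
  move=> i; rewrite addrC addKr normrM (gtr0_norm s0).
  by rewrite (le_trans _ seta) // -[leRHS]mulr1 ler_wpM2l // ltW.
have -> : p.@[fun i => a i + s * x i] = s ^+ d * (s ^- d *: aff (fun=> 0) s q).@[x].
  rewrite mevalZ mulrA mulfV ?mul1r ?expf_neq0 ?gt_eqF // /q aff_comp meval_aff.
  by apply: meval_eq => i; ring.
rewrite mulr_gt0 ?exprn_gt0 //.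
have := meval_nrm (s ^- d *: aff (fun=> 0) s q - dpart (pred1 d) q) x1.
move=> /le_trans/(_ (blowup_nrm s0 s1 dmin)); rewrite mevalB -/v.
rewrite ler_norml => /andP[h _]; move: h; rewrite lerBrDr => h; apply: lt_le_trans h.
have : s * nrm q < v.
  move: sv; rewrite ler_pdivlMr ?mulr_gt0 // /N; have := nrm_ge0 q; nra.
lra.
Qed.

Lemma harmonicN p : harmonic p -> harmonic (- p).
Proof. by move=> hp; rewrite -scaleN1r; exact: harmonicZ. Qed.

Lemma harmonic_sign_change_neg p a (eta : R) : (2 <= n)%N -> harmonic p -> p != 0 ->
  p.@[a] = 0 -> 0 < eta ->
  exists2 b, forall i, `|b i - a i| <= eta & p.@[b] < 0.
Proof.
move=> n2 hp p0 pa eta0.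
have [|||b ba pb] := @harmonic_sign_change (- p) a eta n2 _ _ _ eta0.
- exact: harmonicN.
- by rewrite oppr_eq0.
- by rewrite mevalN pa oppr0.
by exists b => //; rewrite mevalN oppr_gt0 in pb.
Qed.

Lemma sphere_small p q :
  (forall x, \sum_i x i ^+ 2 = 1 -> p.@[x] = 0 -> q.@[x] = 0) ->
  forall e : R, 0 < e -> exists2 eta : R, 0 < eta &
     forall x, \sum_i x i ^+ 2 = 1 -> `|p.@[x]| < eta -> `|q.@[x]| < e.
Proof.
move=> pq e e0; apply: contrapT => h.
have ex (j : nat) : exists x, [/\ \sum_i x i ^+ 2 = 1, `|p.@[x]| < j.+1%:R^-1
    & e <= `|q.@[x]|].
  apply: contrapT => /forallNP h'; apply: h; exists (j.+1%:R^-1); first by rewrite invr_gt0.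
  by move=> x xS px; rewrite ltNge; apply/negP => qx; exact: (h' x).
have [u uP] := choice ex.
have u1 j i : `|u j i| <= 1.
  by have [uS _ _] := uP j; have := en_coord (u j) i; rewrite /en uS sqrtr1.
have [l [f [fj fl]]] := cluster_family u1.
have lim g (e' : R) : 0 < e' -> exists J, forall j, (J <= j)%N -> `|g.@[u (f j)] - g.@[l]| < e'.
  move=> e'0; have [s s0 sP] := meval_cont g l e'0.
  have [J JP] := inv_natS_lt s0; exists J => j /JP Jj; apply: sP => i.
  by apply/ltW/(lt_trans (fl j i)).
have pl : p.@[l] = 0.
  apply/eqP; rewrite -normr_le0; apply/ler_addgt0Pr => e' e'0; rewrite add0r.
  have e2 : 0 < e' / 2 by rewrite divr_gt0.
  have [J JP] := lim p _ e2; have [K KP] := inv_natS_lt e2.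
  pose j := maxn J K; have := JP j (leq_maxl _ _); have := KP j (leq_maxr _ _).
  have [_ pu _] := uP (f j) => h1 h2.
  have h3 : `|p.@[u (f j)]| < e' / 2.
    apply: lt_trans pu (le_lt_trans _ h1).
    by rewrite lef_pV2 ?posrE // ler_nat ltnS fj.
  have := ler_normD (p.@[l] - p.@[u (f j)]) p.@[u (f j)]; rewrite subrK distrC; lra.
have lS : \sum_i l i ^+ 2 = 1.
  rewrite -meval_sqnorm; apply/eqP; rewrite -subr_eq0 -normr_le0.
  apply/ler_addgt0Pr => e' e'0; rewrite add0r.
  have [J JP] := lim (sqnorm R n) _ e'0; have := JP J (leqnn _).
  by have [uS _ _] := uP (f J); rewrite !meval_sqnorm uS distrC => /ltW.
have [J JP] := lim q _ e0; have := JP J (leqnn _); rewrite (pq l lS pl) subr0.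
by have [_ _ qe] := uP (f J); rewrite ltNge qe.
Qed.

Lemma homog_harmonic_zero_sets i m p q : (2 <= n)%N ->
  p \is m.-homog -> q \is i.-homog -> harmonic p -> harmonic q -> (i < m)%N ->
  p != 0 -> q != 0 ->
  (forall x, en x < 1 -> p.@[x] = 0 -> q.@[x] = 0) -> False.
Proof.
move=> n2 pm qi hp hq im p0 q0 pq.
pose P := (nrm p)^-1 *: p; pose Q := (nrm q)^-1 *: q.
have np := nrm_gt0 p0; have nq := nrm_gt0 q0.
have onS x : \sum_i x i ^+ 2 = 1 -> forall i, `|x i| <= 1.
  by move=> xS k; have := en_coord x k; rewrite /en xS sqrtr1.
apply: (@homog_harmonic_zero_sets_aux _ _ n2 m i P Q) => //.
- exact: dhomogZ.
- exact: dhomogZ.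
- exact: harmonicZ.
- exact: harmonicZ.
- by rewrite scaler_eq0 invr_eq0 gt_eqF.
- by rewrite scaler_eq0 invr_eq0 gt_eqF.
- move=> x /onS x1; rewrite !mevalZ !normrM !normfV.
  rewrite (ger0_norm (nrm_ge0 p)) (ger0_norm (nrm_ge0 q)) !ler_pdivrMl // !mulr1.
  by split; exact: meval_nrm.
apply: sphere_small => x xS; rewrite !mevalZ => /eqP.
rewrite mulf_eq0 invr_eq0 gt_eqF //= => /eqP px.
(* The hypothesis concerns the open ball; homogeneity moves a zero on the sphere halfway to the
   origin and back. *)
have : q.@[fun k => 2^-1 * x k] = 0.
  apply: pq; last by rewrite (meval_homog _ _ pm) px mulr0.
  by rewrite enZ /en xS sqrtr1 mulr1 ger0_norm; lra.
rewrite (meval_homog _ _ qi) => /eqP; rewrite mulf_eq0 expf_eq0 invr_eq0 pnatr_eq0 andbF /=.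
by move=> /eqP ->; rewrite mulr0.
Qed.

End Analysis.

(** * Compactness arguments *)

Section Compactness.
Variables (R : realType) (n : nat).
Hypothesis n2 : (2 <= n)%N.
Implicit Types (p q f g P Q F : {mpoly R[n]}) (x y z a b : 'I_n -> R).

Lemma nrm_dist p q : `|nrm p - nrm q| <= nrm (p - q).
Proof.
have h1 := nrmD (p - q) q; have h2 := nrmD (q - p) p.
by rewrite subrK in h1; rewrite subrK nrmBC in h2; rewrite ler_norml; lra.
Qed.

Lemma harmonic_lim P : (forall e : R, 0 < e -> exists2 p, harmonic p & nrm (p - P) < e) ->
  harmonic P.
Proof.
move=> Plim; apply/mpolyP => m; rewrite mcoeff0.
pose c (i : 'I_n) : R := (((m + U_(i))%MM i).+1 * (m i).+1)%:R.
pose C := \sum_i c i + 1.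
have C0 : 0 < C by rewrite ltr_wpDl // sumr_ge0.
apply/eqP; rewrite -normr_le0; apply/ler_addgt0Pr => e e0; rewrite add0r.
have [p hp pP] := Plim (e / C) (divr_gt0 e0 C0).
have -> : (\sum_(i < n) (P^`M(i))^`M(i))@_m = - (\sum_(i < n) ((p - P)^`M(i))^`M(i))@_m.
  under [in RHS]eq_bigr => i _ do rewrite !mderivB.
  by rewrite sumrB hp sub0r mcoeffN opprK.
rewrite normrN mcoeff_lap (le_trans (ler_norm_sum _ _ _)) //.
apply: (@le_trans _ _ (\sum_i c i * (e / C))).
  apply: ler_sum => i _; rewrite -mulrnA -mulr_natl normrM ger0_norm //.
  by rewrite ler_wpM2l // (le_trans (nrm_coef _ _)) // ltW.
rewrite -mulr_suml mulrC mulrAC ler_pdivrMr // ler_pM2l //.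
by rewrite /C lerDl.
Qed.

Lemma dpartB S p q : dpart S (p - q) = dpart S p - dpart S q.
Proof.
apply/mpolyP => m; rewrite mcoeffB !mcoeff_dpart mcoeffB.
by case: ifP => // _; rewrite subr0.
Qed.

(** Near a zero of [p] there are points [b] and [c] where [p] has opposite signs. The approximation
    [p'] keeps these signs, so it vanishes on the segment between them; [q'] then vanishes nearby,
    which bounds |q(a)|. *)
Lemma zero_set_limit p q : harmonic p -> p != 0 ->
  (forall e : R, 0 < e -> exists p' q', [/\ nrm (p' - p) < e, nrm (q' - q) < e &
     forall a, en a < 1 -> p'.@[a] = 0 ->
       exists2 z, en (fun i => a i - z i) < e & q'.@[z] = 0]) ->
  forall a, en a < 1 -> p.@[a] = 0 -> q.@[a] = 0.
Proof.
move=> hp p0 lim a a1 pa; apply/eqP/negPn/negP => qa.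
pose v := `|q.@[a]|; have v0 : 0 < v by rewrite normr_gt0.
have [s1 s10 s1P] := en_open a1.
have [s2 s20 s2P] := @meval_cont _ _ q a (v / 2) (divr_gt0 v0 (ltr0n _ 2)).
pose s := Num.min s1 s2 / 2.
have s0 : 0 < s by rewrite divr_gt0 // lt_min s10.
have [ss1 ss2] : s * 2 <= s1 /\ s * 2 <= s2.
  by rewrite /s divfK ?pnatr_eq0 // !ge_min !lexx orbT.
have inB y : (forall i, `|y i - a i| <= s * 2) -> en y < 1.
  by move=> ya; apply: s1P => i; exact: le_trans (ya i) ss1.
have cube y : en y < 1 -> forall i, `|y i| <= 1.
  by move=> y1 i; exact: le_trans (en_coord y i) (ltW y1).
have [b ba pb] := harmonic_sign_change n2 hp p0 pa s0.
have [c ca pc] := harmonic_sign_change_neg n2 hp p0 pa s0.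
pose e := Num.min (Num.min s (v / 2)) (Num.min p.@[b] (- p.@[c])).
have e0 : 0 < e by rewrite !lt_min s0 divr_gt0 // pb oppr_gt0 pc.
have [es ev eb ec] : [/\ e <= s, e <= v / 2, e <= p.@[b] & e <= - p.@[c]].
  by rewrite !ge_min !lexx !orbT.
have [p' [q' [pp' qq' near]]] := lim e e0.
have box t y y' : 0 <= t <= 1 -> (forall i, `|y i - a i| <= s) ->
    (forall i, `|y' i - a i| <= s) -> forall i, `|y i + t * (y' i - y i) - a i| <= s.
  move=> /andP[t0 t1] ya y'a i.
  have -> : y i + t * (y' i - y i) - a i = (1 - t) * (y i - a i) + t * (y' i - a i) by ring.
  apply: le_trans (ler_normD _ _) _; rewrite !normrM (ger0_norm t0) ger0_norm ?subr_ge0 //.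
  have := ler_wpM2l t0 (y'a i).
  have : 0 <= 1 - t by rewrite subr_ge0.
  by move=> /ler_wpM2l/(_ _ _ (ya i)); lra.
have s2s : s <= s * 2 by lra.
have b1 : en b < 1 by apply: inB => i; exact: le_trans (ba i) s2s.
have c1 : en c < 1 by apply: inB => i; exact: le_trans (ca i) s2s.
have pb' : 0 < p'.@[b].
  have := meval_nrm (p' - p) (cube _ b1); rewrite mevalB ler_norml => /andP[h _]; lra.
have pc' : p'.@[c] < 0.
  have := meval_nrm (p' - p) (cube _ c1); rewrite mevalB ler_norml => /andP[_ h]; lra.
have [t t01 pt] : exists2 t : R, 0 <= t <= 1 &
    p'.@[fun i => b i + t * (c i - b i)] = 0.
  by apply: mpoly_ivt; rewrite pmulr_rle0 // ltW.
set y := fun i => _ in pt; have ya : forall i, `|y i - a i| <= s by exact: box.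
have y1 : en y < 1 by apply: inB => i; exact: le_trans (ya i) s2s.
have [z yz qz] := near y y1 pt.
have za i : `|z i - a i| <= s * 2.
  have h1 := en_coord (fun i => y i - z i) i; rewrite /= in h1.
  have h2 := ler_normD (z i - y i) (y i - a i).
  rewrite addrA subrK (distrC (z i) (y i)) in h2; have h3 := ya i.
  by apply: le_trans h2 _; lra.
have qaz : `|q.@[z] - q.@[a]| < v / 2.
  by apply: s2P => i; exact: le_trans (za i) ss2.
have := meval_nrm (q' - q) (cube _ (inB _ za)); rewrite mevalB qz sub0r normrN => h.
have := ler_normB (q.@[z]) (q.@[z] - q.@[a]).
rewrite opprB addrCA subrr addr0 -/v; lra.
Qed.

(** Blow-up at 0 replaces [P] and [Q] by their lowest homogeneous parts, of degrees m > k and i <=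
    k. Contractions map the ball into itself, so the inclusion of zeros passes to the rescaled
    polynomials and then to the limit. *)
Lemma zero_set_inclusion_order k P Q : harmonic P -> harmonic Q -> P != 0 -> Q != 0 ->
  dpart (fun d => d <= k)%N P = 0 -> (msize Q <= k.+1)%N ->
  (forall a, en a < 1 -> P.@[a] = 0 -> Q.@[a] = 0) -> False.
Proof.
move=> hP hQ P0 Q0 lowP Qk PQ.
have [m [Pm0 mmin]] := lowest_degree P0.
have [i [Qi0 imin]] := lowest_degree Q0.
have km : (k < m)%N.
  rewrite ltnNge; apply: contra Pm0 => mk; apply/eqP/mpolyP => l.
  rewrite mcoeff0 mcoeff_dpart /=; case: eqP => // lm.
  have : (dpart (fun d => d <= k)%N P)@_l = 0 by rewrite lowP mcoeff0.
  by rewrite mcoeff_dpart lm mk.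
have ik : (i <= k)%N.
  have := imin (mlead Q); rewrite mleadc_eq0 => /(_ Q0) h.
  by have := mlead_deg Q0; lia.
apply: (@homog_harmonic_zero_sets _ _ i m (dpart (pred1 m) P) (dpart (pred1 i) Q)) => //.
- exact: dpart_homog.
- exact: dpart_homog.
- exact: harmonic_dpart.
- exact: harmonic_dpart.
- exact: leq_ltn_trans ik km.
apply: zero_set_limit => //; first exact: harmonic_dpart.
move=> e e0; pose N := nrm P + nrm Q + 1.
have [nP nQ] := (nrm_ge0 P, nrm_ge0 Q).
have N0 : 0 < N by rewrite /N; lra.
pose s := Num.min 1 (e / (2 * N)).
have s0 : 0 < s by rewrite lt_min ltr01 divr_gt0 // mulr_gt0.
have [s1 se] : s <= 1 /\ s <= e / (2 * N) by rewrite !ge_min !lexx orbT.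
have sN : s * N < e.
  by move: se; rewrite ler_pdivlMr ?mulr_gt0 //; lra.
have sP0 : 0 <= s * nrm P by rewrite mulr_ge0 // ltW.
have sQ0 : 0 <= s * nrm Q by rewrite mulr_ge0 // ltW.
have sNE : s * N = s * nrm P + s * nrm Q + s by rewrite /N; ring.
exists (s ^- m *: aff (fun=> 0) s P), (s ^- i *: aff (fun=> 0) s Q); split.
- by apply: le_lt_trans (blowup_nrm s0 s1 mmin) _; lra.
- by apply: le_lt_trans (blowup_nrm s0 s1 imin) _; lra.
move=> a a1; rewrite !mevalZ -!meval_scale => /eqP.
rewrite mulf_eq0 invr_eq0 expf_eq0 (gt_eqF s0) andbF /= => /eqP Pa.
exists a; first by rewrite (@eq_en _ _ _ (fun i => 0 * a i)) ?enZ ?normr0 ?mul0r // => j; rewrite subrr mul0r.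
rewrite mevalZ -meval_scale PQ ?mulr0 // enZ gtr0_norm //.
by apply: le_lt_trans a1; rewrite -[leRHS]mul1r ler_wpM2r ?en_ge0.
Qed.

(** By compactness: [e] is both the closeness and the lower bound, so failure for every e = 1/(j +
    1) yields a limit pair excluded by [zero_set_inclusion_order]. *)
Lemma low_part_bound d k : exists2 e : R, 0 < e &
  forall P Q, harmonic P -> harmonic Q -> (msize P <= d)%N -> (msize Q <= k.+1)%N ->
  nrm P = 1 -> nrm Q = 1 ->
  (forall a, en a < 1 -> P.@[a] = 0 ->
       exists2 z, en (fun i => a i - z i) < e & Q.@[z] = 0) ->
  e <= nrm (dpart (fun d => d <= k)%N P).
Proof.
pose low := dpart (R := R) (n := n) (fun d => d <= k)%N.
pose close P Q (e : R) := forall a, en a < 1 -> P.@[a] = 0 ->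
       exists2 z, en (fun i => a i - z i) < e & Q.@[z] = 0.
apply: contrapT => h.
have ex (j : nat) : exists PQ : {mpoly R[n]} * {mpoly R[n]},
    [/\ harmonic PQ.1, harmonic PQ.2, (msize PQ.1 <= d)%N & (msize PQ.2 <= k.+1)%N]
    /\ [/\ nrm PQ.1 = 1, nrm PQ.2 = 1, close PQ.1 PQ.2 j.+1%:R^-1 & nrm (low PQ.1) < j.+1%:R^-1].
  apply: contrapT => /forallNP h'; apply: h; exists j.+1%:R^-1; first by rewrite invr_gt0.
  move=> P Q hP hQ Pd Qk P1 Q1 PQ; rewrite leNgt; apply/negP => lowP.
  by apply: (h' (P, Q)).
have [u uP] := choice ex.
have [||P0 [f [P0d fj fP]]] := @mpoly_cluster _ _ d (fun j => (u j).1) 1.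
- by move=> j; have [[]] := uP j.
- by move=> j; have [_ [-> _ _ _]] := uP j.
(* The second extraction is made along the first, so both polynomials converge along [f (g j)]. *)
have [||Q0 [g [Q0d gj gQ]]] := @mpoly_cluster _ _ k.+1 (fun j => (u (f j)).2) 1.
- by move=> j; have [[]] := uP (f j).
- by move=> j; have [_ [_ -> _ _]] := uP (f j).
have lim (e : R) : 0 < e -> exists PQ : {mpoly R[n]} * {mpoly R[n]},
   [/\ nrm (PQ.1 - P0) < e, nrm (PQ.2 - Q0) < e, nrm PQ.1 = 1 & nrm PQ.2 = 1]
   /\ [/\ harmonic PQ.1, harmonic PQ.2, nrm (low PQ.1) < e & close PQ.1 PQ.2 e].
  move=> e0; have [J JP] := fP e e0; have [K KP] := gQ e e0.
  have [L LP] := inv_natS_lt e0.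
  pose j := maxn (maxn J K) L; exists (u (f (g j))).
  have gJ : (J <= g j)%N by apply: leq_trans (gj j); rewrite /j !leq_max leqnn.
  have jK : (K <= j)%N by rewrite /j !leq_max leqnn orbT.
  have fL : (f (g j)).+1%:R^-1 < e.
    by apply: LP; apply: leq_trans (fj _); apply: leq_trans (gj _); rewrite /j leq_maxr.
  have [[h1 h2 _ _] [n1 n2' cl lw]] := uP (f (g j)); split; split => //.
  - exact: JP.
  - exact: KP.
  - exact: lt_trans lw fL.
  - move=> a a1 Pa; have [z az Qz] := cl a a1 Pa; exists z => //.
    exact: lt_trans az fL.
have hP0 : harmonic P0.
  by apply: harmonic_lim => e /lim[[p q] [[/= h1 _ _ _] [h2 _ _ _]]]; exists p.
have hQ0 : harmonic Q0.
  by apply: harmonic_lim => e /lim[[p q] [[/= _ h1 _ _] [_ h2 _ _]]]; exists q.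
have nP0 : P0 != 0.
  have [[p q] [[/= h1 _ h2 _] _]] := lim 1 ltr01; apply: contraTneq h1 => ->.
  by rewrite subr0 h2 ltxx.
have nQ0 : Q0 != 0.
  have [[p q] [[/= _ h1 _ h2] _]] := lim 1 ltr01; apply: contraTneq h1 => ->.
  by rewrite subr0 h2 ltxx.
apply: (@zero_set_inclusion_order k P0 Q0) => //.
  apply: nrm_eq0; apply/le_anti; rewrite nrm_ge0 andbT.
  apply/ler_addgt0Pr => e e0; rewrite add0r.
  have e2 : 0 < e / 2 by rewrite divr_gt0.
  have [[p q] [[/= h1 _ _ _] [_ _ h2 _]]] := lim _ e2.
  have := nrm_dist (low P0) (low p); rewrite -dpartB => /le_trans/(_ (nrm_dpart _ _)).
  rewrite nrmBC => /(le_trans (ler_norm _)); rewrite /low in h2 *; lra.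
apply: zero_set_limit => // e /lim[[p q] [[/= h1 h2 _ _] [_ _ _ h3]]].
by exists p, q.
Qed.

(** Harnack's inequality by compactness: otherwise a limit of norm 1 would be harmonic, nonnegative
    on the ball and 0 at its centre, contrary to the sign change there. *)
Lemma harnack_nrm D : exists2 C : R, 0 < C &
  forall q, harmonic q -> (msize q <= D)%N ->
    (forall y, en y < 1 -> 0 <= q.@[y]) -> nrm q <= C * q.@[fun=> 0].
Proof.
apply: contrapT => h.
have en0 : en (fun _ : 'I_n => 0 : R) < 1.
  by rewrite en_lt1 big1 // => i _; rewrite expr0n.
have ex (j : nat) : exists q, [/\ harmonic q, (msize q <= D)%N,
    forall y, en y < 1 -> 0 <= q.@[y], nrm q = 1 & q.@[fun=> 0] < j.+1%:R^-1].
  apply: contrapT => /forallNP h'; apply: h; exists j.+1%:R => // q hq qD q0.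
  rewrite leNgt; apply/negP => lt.
  have nq : 0 < nrm q by apply: le_lt_trans lt; rewrite mulr_ge0 // q0.
  apply: (h' ((nrm q)^-1 *: q)); split.
  - exact: harmonicZ.
  - exact: leq_trans (msizeZ_le _ _) qD.
  - by move=> y y1; rewrite mevalZ mulr_ge0 ?q0 // invr_ge0 nrm_ge0.
  - by rewrite nrmZE normfV (gtr0_norm nq) mulVf // gt_eqF.
  - by rewrite mevalZ ltr_pdivrMl // mulrC ltr_pdivlMl.
have [u uP] := choice ex.
have [||q [f [qD fj fP]]] := @mpoly_cluster _ _ D u 1.
- by move=> j; have [] := uP j.
- by move=> j; have [_ _ _ -> _] := uP j.
have lim (e : R) : 0 < e -> exists p, [/\ harmonic p, nrm (p - q) < e,
    forall y, en y < 1 -> 0 <= p.@[y], nrm p = 1 & p.@[fun=> 0] < e].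
  move=> e0; have [J JP] := fP e e0; have [L LP] := inv_natS_lt e0.
  pose j := maxn J L; exists (u (f j)).
  have [h1 h2 h3 h4 h5] := uP (f j); split => //.
    by apply: JP; rewrite leq_maxl.
  apply: lt_trans h5 (LP _ _); apply: leq_trans (fj _); exact: leq_maxr.
have hq : harmonic q.
  by apply: harmonic_lim => e /lim[p [h1 h2 _ _ _]]; exists p.
have nq0 : q != 0.
  have [p [_ h1 _ h2 _]] := lim 1 ltr01; apply: contraTneq h1 => ->.
  by rewrite subr0 h2 ltxx.
have cube y : en y < 1 -> forall i, `|y i| <= 1.
  by move=> y1 i; exact: le_trans (en_coord y i) (ltW y1).
have q_ge0 y : en y < 1 -> 0 <= q.@[y].
  move=> y1; rewrite -oppr_le0; apply/ler_addgt0Pr => e e0; rewrite add0r.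
  have [p [_ h1 h2 _ _]] := lim e e0; have := h2 y y1.
  have := meval_nrm (p - q) (cube y y1); rewrite mevalB ler_norml => /andP[_]; lra.
have q0 : q.@[fun=> 0] = 0.
  apply/le_anti; rewrite q_ge0 // andbT; apply/ler_addgt0Pr => e e0; rewrite add0r.
  have e2 : 0 < e / 2 by rewrite divr_gt0.
  have [p [_ h1 h2 _ h3]] := lim _ e2.
  have := meval_nrm (p - q) (cube _ en0); rewrite mevalB ler_norml => /andP[h4 _]; lra.
have eta0 : 0 < n.+1%:R^-1 :> R by rewrite invr_gt0.
have [b b0 qb] := harmonic_sign_change_neg n2 hq nq0 q0 eta0.
have : en b < 1 by apply: en_box => i; have := b0 i; rewrite subr0.
by move=> /q_ge0; rewrite leNgt qb.
Qed.

(** On the zero-free ball [F] has constant sign, so Harnack bounds all of [aff a rho F] by |F(a)|.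
    Thus [aff a rho Q] is O(s^(k+1)), and undoing this substitution costs only (2/rho)^k, since [Q]
    has degree at most [k]. *)
Lemma zero_free_radius_bound d k (c : R) : (0 < k)%N -> (k <= d)%N -> 0 < c ->
  exists2 C : R, 0 < C & forall F Q (s rho : R) a,
  harmonic F -> (msize F <= d.+1)%N -> (msize Q <= k.+1)%N -> 0 < s ->
  c * s ^+ k <= nrm Q -> nrm (F - Q) <= s ^+ k.+1 -> (forall i, `|a i| <= 1) ->
  0 <= rho -> rho <= 1 -> `|F.@[a]| <= s ^+ k.+1 ->
  (forall y, en y < 1 -> F.@[fun i => a i + rho * y i] <> 0) ->
  rho ^+ k <= C * s.
Proof.
move=> k0 kd c0; have [CH CH0 harn] := harnack_nrm d.+1.
(* [CH] bounds the contribution of [F], and 2^d that of F - Q, as |a_i| + rho <= 2. *)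
pose K := CH + 2 ^+ d; have K0 : 0 < K by rewrite addr_gt0 // exprn_gt0.
have C0 : 0 < 2 ^+ k * K / c by rewrite divr_gt0 // mulr_gt0 // exprn_gt0.
exists (2 ^+ k * K / c) => // F Q s rho a hF Fd Qk s0 cQ FQ a1 rho0 rho1 Fa Fn0.
have [->|rhon0] := eqVneq rho 0.
  by rewrite expr0n eqn0Ngt k0 mulr_ge0 // ltW.
have rho_gt0 : 0 < rho by rewrite lt_def rhon0.
pose G := aff a rho F.
have GE y : G.@[y] = F.@[fun i => a i + rho * y i] by rewrite meval_aff.
have hG : harmonic G by exact: harmonic_aff.
have Gd : (msize G <= d.+1)%N by exact: msize_aff.
have en0 : en (fun _ : 'I_n => 0 : R) < 1.
  by rewrite en_lt1 big1 // => i _; rewrite expr0n.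
have G0 : G.@[fun=> 0] = F.@[a] by rewrite GE; apply: meval_eq => i; ring.
have sgn y : en y < 1 -> 0 < G.@[fun=> 0] * G.@[y].
  move=> y1; rewrite ltNge; apply/negP => le.
  have [t /andP[t0 t1] Gt] := mpoly_ivt le.
  apply: (Fn0 (fun i => t * y i)).
    by rewrite enZ ger0_norm // (le_lt_trans _ y1) // -[leRHS]mul1r ler_wpM2r ?en_ge0.
  by rewrite -Gt GE; apply: meval_eq => i; ring.
have nG : nrm G <= CH * s ^+ k.+1.
  apply: (@le_trans _ _ (CH * `|F.@[a]|)); last by rewrite ler_wpM2l // ltW.
  rewrite -G0; have [Gp|Gn] := leP 0 G.@[fun=> 0].
    rewrite ger0_norm //; apply: harn => // y /sgn h.
    by rewrite ltW // -(@pmulr_rgt0 _ G.@[fun=> 0]) // lt_def Gp andbT; apply: contraTneq h => ->; rewrite mul0r ltxx.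
  rewrite ltr0_norm // -nrmN -mevalN; apply: harn => //.
  - exact: harmonicN.
  - by rewrite msizeN.
  - by move=> y /sgn; rewrite nmulr_rgt0 // mevalN oppr_ge0 => /ltW.
have FQd : (msize (F - Q) <= d.+1)%N.
  rewrite (leq_trans (msizeD_le _ _)) // geq_max Fd msizeN.
  by apply: leq_trans Qk _; rewrite ltnS.
have nFQ : nrm (aff a rho (F - Q)) <= 2 ^+ d * s ^+ k.+1.
  apply: (@le_trans _ _ (2 ^+ d * nrm (F - Q))); last by rewrite ler_wpM2l ?exprn_ge0.
  apply: nrm_aff => // [|i]; first by rewrite ler1n.
  rewrite (gtr0_norm rho_gt0); have := a1 i; lra.
have nQ : nrm (aff a rho Q) <= K * s ^+ k.+1.
  have -> : aff a rho Q = G - aff a rho (F - Q) by rewrite affB opprB addrC subrK.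
  by apply: le_trans (nrmB _ _) _; rewrite /K mulrDl lerD.
have nQ' : nrm Q <= (2 / rho) ^+ k * nrm (aff a rho Q).
  rewrite -{1}(affK a Q rhon0); apply: nrm_aff.
  - by rewrite ler_pdivlMr // mul1r; lra.
  - move=> i; rewrite normrN normrM normfV.
    rewrite (gtr0_norm rho_gt0) -[X in _ + X]mul1r -mulrDl ler_pM2r ?invr_gt0 //.
    by have := a1 i; lra.
  - exact: msize_aff.
have h : c * s ^+ k <= (2 / rho) ^+ k * (K * s ^+ k.+1).
  apply: le_trans cQ (le_trans nQ' _); rewrite ler_wpM2l // exprn_ge0 //.
  by rewrite divr_ge0.
move: h; rewrite expr_div_n exprSr.
have -> : 2 ^+ k / rho ^+ k * (K * (s ^+ k * s)) = (2 ^+ k * K * s / rho ^+ k) * s ^+ k by ring.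
rewrite ler_pM2r ?exprn_gt0 // ler_pdivlMr ?exprn_gt0 // => h.
rewrite mulrAC ler_pdivlMr // mulrC; exact: h.
Qed.

End Compactness.

(** * Bounds for Theta *)

Section ThetaBounds.
Variables (R : realType) (n : nat).
Implicit Types (p q P Q F : {mpoly R[n]}) (x y z a b : 'rV[R]_n) (A S : set 'rV[R]_n).
Local Open Scope classical_set_scope.
Local Open Scope ring_scope.

Lemma enorm_en x : enorm x = en (x 0). Proof. by []. Qed.

Lemma enormZ (c : R) x : enorm (c *: x) = `|c| * enorm x.
Proof. by rewrite !enorm_en -enZ; apply: eq_en => i; rewrite mxE. Qed.

Lemma enorm0 : enorm (0 : 'rV[R]_n) = 0.
Proof. by rewrite -(scale0r 0) enormZ normr0 mul0r. Qed.

Lemma dist_set_le a s S : S s -> dist_set a S <= enorm (a - s).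
Proof.
move=> Ss; apply: ge_inf; last by exists s.
by exists 0 => _ [t _ <-]; exact: en_ge0.
Qed.

Lemma dist_set_ge0 a S : S !=set0 -> 0 <= dist_set a S.
Proof.
move=> [s Ss]; apply: lb_le_inf; first by exists (enorm (a - s)), s.
by move=> _ [t _ <-]; exact: en_ge0.
Qed.

Lemma dist_set_lt a S (e : R) : S !=set0 -> dist_set a S < e ->
  exists2 s, S s & enorm (a - s) < e.
Proof.
move=> [s Ss] /inf_lt[|_ [t St <-] te]; first by exists (enorm (a - s)), s.
by exists t.
Qed.

Lemma translateP x S y : translate x S y <-> S (y - x).
Proof.
split=> [[s Ss <-]|Sy]; first by rewrite addrC addKr.
by exists (y - x) => //; rewrite addrC subrK.
Qed.

Lemma sup_ge0 (E : set R) : (forall c, E c -> 0 <= c) -> 0 <= sup E.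
Proof.
move=> E0; have [hE|hE] := pselect (has_sup E); last by rewrite sup_out.
have [[y Ey] ub] := hE; apply: le_trans (E0 y Ey) _; exact: ub_le_sup.
Qed.

Lemma Theta_le k A x (r M : R) S : 0 < r -> A x ->
  harmonic_zero_sets k S ->
  (forall a, A a -> enorm (a - x) < r -> dist_set a (translate x S) <= M) ->
  (forall z, S (z - x) -> enorm (z - x) < r -> dist_set z A <= M) ->
  Theta k A x r <= r^-1 * M.
Proof.
move=> r0 Ax HS hA hS; rewrite /Theta ler_pM2l ?invr_gt0 //.
have S0 : S 0 by case: HS => q [_ _ _ q0 ->].
have xx : enorm (x - x) < r by rewrite subrr enorm0.
apply: (@le_trans _ _ (Num.max
  (sup [set dist_set a (translate x S) | a in A `&` eball x r])
  (sup [set dist_set z A | z in translate x S `&` eball x r]))).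
  apply: ge_inf; last by exists S.
  (* The infimum is a true one: the first of the two suprema is always nonnegative. *)
  exists 0 => _ [T HT <-]; rewrite le_max; apply/orP; left; apply: sup_ge0.
  move=> _ [a [Aa _] <-]; apply: dist_set_ge0; exists x; apply/translateP.
  by case: HT => q [_ _ _ q0 ->]; rewrite subrr.
rewrite ge_max; apply/andP; split; apply: ge_sup.
- by exists (dist_set x (translate x S)), x.
- by move=> _ [a [Aa ax] <-]; exact: hA.
- exists (dist_set x A), x => //; split => //; apply/translateP.
  by rewrite subrr.
- by move=> _ [z [/translateP Sz zx] <-]; exact: hS.
Qed.

Lemma harmonic_zero_sets_nonempty k : (0 < n)%N -> (0 < k)%N ->
  @harmonic_zero_sets R n k !=set0.
Proof.
move=> n0 k0; pose i := Ordinal n0; exists (zero_set ('X_i : {mpoly R[n]})), 'X_i.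
split => //; rewrite ?msizeX ?mdeg1 //; last by rewrite mevalXU mxE.
rewrite /harmonic big1 // => j _; rewrite mderivX mderivZ.
case ji : (i == j); last by rewrite mnm1E ji scale0r.
rewrite -(eqP ji) (_ : (U_(i) - U_(i) = 0 :> 'X_{1..n})%MM).
  by rewrite mpolyX0 -mpolyC1 mderivC scaler0.
by apply/mnmP => l; rewrite mnmBE subnn mnm0E.
Qed.

(** Only the first supremum is retained: the lower bound for Theta rests on zeros of p being close
    to zeros of q, not on the converse. *)
Lemma Theta_lt k A x (r e : R) : (0 < n)%N -> (0 < k)%N -> 0 < r -> A x ->
  Theta k A x r < e -> exists2 S, harmonic_zero_sets k S &
  forall a, A a -> enorm (a - x) < r -> dist_set a (translate x S) < e * r.
Proof.
move=> n0 k0 r0 Ax; rewrite /Theta mulrC ltr_pdivrMr // => /inf_lt[].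
  by have [S HS] := harmonic_zero_sets_nonempty n0 k0; eexists; exists S; [exact: HS|].
move=> _ [S HS <-]; rewrite gt_max => /andP[h _]; exists S => // a Aa ax.
apply: le_lt_trans h; apply: ub_le_sup; last by exists a.
(* The supremum is a true one: [x] lies in [translate x S], so the distances are bounded by [r]. *)
exists r => _ [b [Ab bx] <-]; apply: le_trans (ltW bx); apply: dist_set_le.
by apply/translateP; case: HS => q [_ _ _ q0 ->]; rewrite subrr.
Qed.

Lemma dpartZ (S : pred nat) (c : R) p : dpart S (c *: p) = c *: dpart S p.
Proof.
apply/mpolyP => m; rewrite mcoeffZ !mcoeff_dpart mcoeffZ.
by case: ifP => // _; rewrite mulr0.
Qed.

Lemma nrm_normalize p : p != 0 -> nrm ((nrm p)^-1 *: p) = 1.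
Proof.
move=> p0; have np := nrm_gt0 p0.
by rewrite nrmZE normfV gtr0_norm // mulVf // gt_eqF.
Qed.

Lemma nrm_dpart_normalize (S : pred nat) p :
  nrm (dpart S ((nrm p)^-1 *: p)) = (nrm p)^-1 * nrm (dpart S p).
Proof. by rewrite dpartZ nrmZE normfV ger0_norm // nrm_ge0. Qed.

Definition low k p : {mpoly R[n]} := dpart (fun d => d <= k)%N p.

(** Rescaling the ball of radius [r] about [x] to the unit ball and normalizing both polynomials
    reduces this to [low_part_bound]. *)
Lemma low_nonzero_of_Theta_lt d k : (2 <= n)%N -> (0 < k)%N ->
  exists2 e : R, 0 < e & forall p x (r : R), harmonic p -> p != 0 ->
  (msize p <= d)%N -> zero_set p x -> 0 < r -> Theta k (zero_set p) x r < e ->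
  e * nrm (aff (x 0) r p) <= nrm (low k (aff (x 0) r p)).
Proof.
move=> n2 k0; have n0 : (0 < n)%N by exact: ltn_trans n2.
have [e e0 eP] := low_part_bound R n2 d k; exists e => //.
move=> p x r hp p0 pd px r0 /(Theta_lt n0 k0 r0 px)[S [q [hq q1 qk q0 ->]] near].
set f := aff (x 0) r p.
have f0 : f != 0 by rewrite aff_eq0 // gt_eqF.
have qn0 : q != 0 by apply: contraTneq q1 => ->; rewrite mmeasure0.
set g := aff (fun=> 0) r q; have g0 : g != 0 by rewrite aff_eq0 // gt_eqF.
have [nf ng] := (nrm_gt0 f0, nrm_gt0 g0).
suff : e <= nrm (low k ((nrm f)^-1 *: f)).
  by rewrite nrm_dpart_normalize ler_pdivlMl // mulrC.
apply: (eP _ ((nrm g)^-1 *: g)); rewrite ?nrm_normalize //.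
- by apply: harmonicZ; exact: harmonic_aff.
- by apply: harmonicZ; exact: harmonic_aff.
- by apply: leq_trans (msizeZ_le _ _) _; exact: msize_aff.
- by apply: leq_trans (msizeZ_le _ _) _; exact: msize_aff.
move=> a a1; rewrite mevalZ => /eqP.
rewrite mulf_eq0 invr_eq0 (gt_eqF nf) /= => /eqP fa.
pose w : 'rV[R]_n := \row_i a i.
have wa : w 0 =1 a by move=> i; rewrite mxE.
pose b := x + r *: w.
have pb : zero_set p b.
  rewrite /zero_set /= -fa meval_aff; apply: meval_eq => i.
  by rewrite mxE mxE wa.
have bx : enorm (b - x) < r.
  rewrite /b addrC addKr enormZ gtr0_norm // -[ltRHS]mulr1 ltr_pM2l //.
  by rewrite enorm_en (eq_en wa).
have [|t /translateP ts tb] := dist_set_lt _ (near b pb bx).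
  by exists x; apply/translateP; rewrite subrr.
exists (fun i => (t - x) 0 i / r).
  have -> : en (fun i => a i - (t - x) 0 i / r) = r^-1 * enorm (b - t).
    have rv : `|r^-1| = r^-1 by rewrite gtr0_norm ?invr_gt0.
    rewrite enorm_en -[in RHS]rv -enZ; apply: eq_en => i.
    by rewrite !mxE; field; rewrite gt_eqF.
  by rewrite ltr_pdivrMl // mulrC.
rewrite mevalZ /g -meval_scale.
suff -> : q.@[fun i => r * ((t - x) 0 i / r)] = q.@[(t - x) 0].
  by rewrite (ts : q.@[_] = 0) mulr0.
by apply: meval_eq => i; rewrite mulrC divfK // gt_eqF.
Qed.

(** The competitor in the infimum is the zero set of the Taylor polynomial of p at [x] of degree at
    most [k]; [zero_free_radius_bound] controls both distances. *)
Lemma Theta_le_of_low d k (c : R) : (2 <= n)%N -> (0 < k)%N -> (k <= d)%N -> 0 < c ->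
  exists2 C : R, 0 < C & forall p x (r s : R), harmonic p -> p != 0 ->
  (msize p <= d.+1)%N -> zero_set p x -> 0 < r -> 0 < s -> s <= 1 ->
  c * nrm (aff (x 0) r p) <= nrm (low k (aff (x 0) r p)) ->
  Theta k (zero_set p) x (s * r) <= (C * s) `^ (k%:R^-1).
Proof.
move=> n2 k0 kd c0; have [C C0 CP] := zero_free_radius_bound n2 k0 kd c0.
exists C => // p x r s hp p0 pd px r0 s0 s1 lowc.
set f := aff (x 0) r p in lowc.
have f0 : f != 0 by rewrite aff_eq0 // gt_eqF.
have nf := nrm_gt0 f0; have nfi : (nrm f)^-1 != 0 by rewrite invr_eq0 gt_eqF.
pose P0 := (nrm f)^-1 *: f; pose Q0 := low k P0.
have nP0 : nrm P0 = 1 by exact: nrm_normalize.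
have nQ0 : c <= nrm Q0.
  by rewrite nrm_dpart_normalize ler_pdivlMl // mulrC.
have hP0 : harmonic P0 by apply: harmonicZ; exact: harmonic_aff.
have hQ0 : harmonic Q0 by exact: harmonic_dpart.
have P0d : (msize P0 <= d.+1)%N.
  by apply: leq_trans (msizeZ_le _ _) _; exact: msize_aff.
have Q0k : (msize Q0 <= k.+1)%N by exact: msize_dpart_low.
have Q0n0 : Q0 != 0.
  by apply: contraTneq nQ0 => ->; rewrite nrm0 -ltNge.
pose F := aff (fun=> 0) s P0; pose Q := aff (fun=> 0) s Q0.
have hF : harmonic F by exact: harmonic_aff.
have hQ : harmonic Q by exact: harmonic_aff.
have Fd : (msize F <= d.+1)%N by exact: msize_aff.
have Qk : (msize Q <= k.+1)%N by exact: msize_aff.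
have Qd : (msize Q <= d.+1)%N by exact: leq_trans Qk _.
have cQ : c * s ^+ k <= nrm Q.
  apply: le_trans (nrm_aff0_low s0 s1 Q0k).
  by rewrite mulrC ler_wpM2l // exprn_ge0 // ltW.
have FQ : nrm (F - Q) <= s ^+ k.+1.
  by have := nrm_aff0_high k P0 s0 s1; rewrite nP0 mulr1.
have QQ : nrm (Q - Q) <= s ^+ k.+1.
  by rewrite subrr nrm0 exprn_ge0 // ltW.
pose t := s * r; have t0 : 0 < t by rewrite mulr_gt0.
have FE y : F.@[y 0] = 0 <-> zero_set p (x + t *: y).
  rewrite /F -meval_scale mevalZ /f meval_aff.
  have -> : p.@[fun i => x 0 i + r * (s * y 0 i)] = p.@[(x + t *: y) 0].
    by apply: meval_eq => i; rewrite !mxE /t; ring.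
  split=> [/eqP|h]; last by rewrite (h : p.@[_] = 0) mulr0.
  by rewrite mulf_eq0 (negPf nfi) => /eqP.
(* Undoing the scale [r] gives that Taylor polynomial, up to translation by [x] and a constant
   factor. *)
pose q := aff (fun=> 0) r^-1 Q0.
have QE y : Q.@[y 0] = 0 <-> zero_set q (t *: y).
  rewrite /zero_set /= /q /Q -!meval_scale.
  suff -> : Q0.@[fun i => r^-1 * (t *: y) 0 i] = Q0.@[fun i => s * y 0 i] by [].
  by apply: meval_eq => i; rewrite mxE /t; field; rewrite gt_eqF.
have Q00 : Q0.@[fun=> 0] = 0.
  rewrite meval_origin mcoeff_dpart mdeg0 leq0n -meval_origin mevalZ /f meval_aff.
  suff -> : p.@[fun i => x 0 i + r * 0] = p.@[x 0].
    by rewrite (px : p.@[x 0] = 0) mulr0.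
  by apply: meval_eq => i; rewrite mulr0 addr0.
have q0 : q.@[(0 : 'rV[R]_n) 0] = 0.
  rewrite /q -meval_scale -[RHS]Q00; apply: meval_eq => i.
  by rewrite mxE mulr0.
have hq : harmonic q by exact: harmonic_aff.
have qk : (msize q <= k.+1)%N by exact: msize_aff.
have qn0 : q != 0 by rewrite aff_eq0 // invr_eq0 gt_eqF.
clearbody q.
have HS : harmonic_zero_sets k (zero_set q).
  exists q; apply: And5 => //; rewrite ltnNge; apply/negP => /msize1_polyC qC.
  case/eqP: qn0; rewrite qC -meval_origin -[RHS](mpolyC0 n) -q0; congr _%:MP.
  by apply: meval_eq => i; rewrite mxE.
have powb (rho : R) : 0 <= rho -> rho ^+ k <= C * s -> rho <= (C * s) `^ (k%:R^-1).
  move=> rho0 h; have kn0 : k%:R != 0 :> R by rewrite pnatr_eq0 -lt0n.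
  have -> : rho = (rho ^+ k) `^ (k%:R^-1).
    by rewrite -powR_mulrn // -powRrM mulfV // powRr1.
  have Cs0 : 0 <= C * s by rewrite mulr_ge0 // ltW.
  by apply: ge0_ler_powR; rewrite ?nnegrE ?exprn_ge0 ?invr_ge0 ?ler0n.
have point b : b = x + t *: (t^-1 *: (b - x)).
  by rewrite scalerA mulfV ?gt_eqF // scale1r addrC subrK.
have small b : enorm (b - x) < t -> enorm (t^-1 *: (b - x)) < 1.
  by move=> bx; rewrite enormZ gtr0_norm ?invr_gt0 // ltr_pdivrMl // mulr1.
(* Serves both suprema: G = Q with the translated zero set of [q], and G = F with that of p. The
   radius is the distance from [b] to [A] in units of [t], so a zero of [G] in that ball would be
   too close to [b]. *)
have main (G : {mpoly R[n]}) (A : set 'rV[R]_n) b :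
    harmonic G -> (msize G <= d.+1)%N -> nrm (G - Q) <= s ^+ k.+1 ->
    (forall y, G.@[y 0] = 0 -> A (x + t *: y)) -> A x -> enorm (b - x) < t ->
    `|G.@[(t^-1 *: (b - x)) 0]| <= s ^+ k.+1 ->
    dist_set b A <= t * (C * s) `^ (k%:R^-1).
  move=> hG Gd GQ GA Ax bx Gb; set v := t^-1 *: (b - x) in Gb.
  have D0 : 0 <= dist_set b A by apply: dist_set_ge0; exists x.
  pose rho := dist_set b A / t.
  have rho0 : 0 <= rho by rewrite divr_ge0 // ltW.
  rewrite -ler_pdivrMl // mulrC -/rho; apply: powb => //.
  have [->|rhon0] := eqVneq rho 0.
    by rewrite expr0n eqn0Ngt k0 mulr_ge0 // ltW.
  have v1 i : `|v 0 i| <= 1.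
    by apply: le_trans (en_coord _ _) _; rewrite -enorm_en ltW // small.
  apply: (CP G Q s rho (v 0)) => //.
    rewrite ler_pdivrMr // mul1r (le_trans (dist_set_le b Ax)) //.
    exact: ltW.
  move=> y y1 Gy; pose w : 'rV[R]_n := \row_i y i.
  have : dist_set b A <= enorm (b - (x + t *: (v + rho *: w))).
    apply: dist_set_le; apply: GA; rewrite -[RHS]Gy; apply: meval_eq => i.
    by rewrite !mxE.
  rewrite {2}(point b) -/v opprD addrACA subrr add0r -scalerBr opprD addrA subrr sub0r.
  rewrite scalerN -scaleNr scalerA enormZ normrM normrN (gtr0_norm t0) (ger0_norm rho0).
  have wy : enorm w = en y by rewrite enorm_en; apply: eq_en => i; rewrite mxE.
  rewrite wy /rho mulrCA mulfV ?gt_eqF // mulr1 leNgt => /negP; apply.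
  rewrite -[ltRHS]mulr1 ltr_pM2l // lt_def D0 andbT.
  by apply: contraNneq rhon0; rewrite /rho => ->; rewrite mul0r.
rewrite -/t; have -> : (C * s) `^ (k%:R^-1) = t^-1 * (t * (C * s) `^ (k%:R^-1)).
  by rewrite mulKf // gt_eqF.
apply: (@Theta_le _ _ _ _ _ (zero_set q)) => //.
- move=> a pa ax; apply: (main Q) => //.
  + by move=> y Qy; apply/translateP; rewrite addrC addKr; apply/QE.
  + by apply/translateP; rewrite subrr.
  + have Fa : F.@[(t^-1 *: (a - x)) 0] = 0 by apply/FE; rewrite -point.
    have := meval_nrm (F - Q) (x := (t^-1 *: (a - x)) 0).
    rewrite mevalB Fa sub0r normrN => h; apply: le_trans (h _) FQ => i.
    by apply: le_trans (en_coord _ _) _; rewrite -enorm_en ltW // small.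
- move=> z qz zx; apply: (main F) => //.
  + by move=> y /FE.
  + have Qz : Q.@[(t^-1 *: (z - x)) 0] = 0.
      by apply/QE; rewrite scalerA mulfV ?gt_eqF // scale1r.
    have := meval_nrm (F - Q) (x := (t^-1 *: (z - x)) 0).
    rewrite mevalB Qz subr0 => h; apply: le_trans (h _) FQ => i.
    by apply: le_trans (en_coord _ _) _; rewrite -enorm_en ltW // small.
Qed.

Lemma mderivm_aff (y : 'I_n -> R) (r : R) p (a : 'X_{1..n}) :
  (aff y r p)^`M[a] = r ^+ mdeg a *: aff y r p^`M[a].
Proof.
have iterE i k (q : {mpoly R[n]}) (c : R) :
    iter k (mderiv i) (c *: aff y r q) = (c * r ^+ k) *: aff y r (iter k (mderiv i) q).
  elim: k => [|k IH]; first by rewrite mulr1.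
  by rewrite !iterS IH mderivZ mderiv_aff scalerA exprSr mulrA.
rewrite /mderivm mdegE -[in RHS]big_enum /=.
elim: (enum 'I_n) => [|i s IH]; first by rewrite big_nil scale1r.
by rewrite /= IH iterE big_cons exprD mulrC.
Qed.

(** Taylor's formula: up to the nonzero factor r^|a| / a!, the coefficients of the rescaled
    polynomial are the partial derivatives at [x]. *)
Lemma low_aff_eq0 k p x (r : R) : r != 0 ->
  (low k (aff (x 0) r p) = 0) <->
  (forall a : 'X_{1..n}, (mdeg a <= k)%N -> (p^`M[a]).@[x 0] = 0).
Proof.
move=> r0; have key (a : 'X_{1..n}) :
    ((aff (x 0) r p)@_a = 0) <-> ((p^`M[a]).@[x 0] = 0).
  have : (aff (x 0) r p)^`M[a]@_0 = r ^+ mdeg a * (p^`M[a]).@[x 0].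
    rewrite mderivm_aff -meval_origin mevalZ meval_aff; congr (_ * _).
    by apply: meval_eq => i; rewrite mulr0 addr0.
  rewrite mcoeff_mderivm addm0 => h; split => [a0|a0].
    move: h; rewrite a0 mul0rn => /esym/eqP.
    by rewrite mulf_eq0 expf_eq0 (negPf r0) andbF => /eqP.
  apply/eqP; move: h; rewrite a0 mulr0 => /eqP.
  rewrite mulrn_eq0 => /orP[|//]; rewrite -leqn0 leqNgt => /negP[].
  by apply: prodn_gt0 => i; rewrite ffactnn fact_gt0.
split=> [h a ak|h]; last first.
  apply/mpolyP => a; rewrite mcoeff_dpart mcoeff0; case: ifP => // /h.
  by move/key.
by apply/key; have := mcoeff_dpart (fun d => d <= k)%N (aff (x 0) r p) a; rewrite -/(low k _) h mcoeff0 ak.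
Qed.

End ThetaBounds.

(** * The two equivalences and the decay of Theta *)

Theorem theorem1p4 (R : realType) (n d k : nat)
    (hn : (2 <= n)%N) (hk : (1 <= k)%N) (hkd : (k < d)%N) :
  exists delta : R, 0 < delta /\
    (forall (p : {mpoly R[n]}) (x : 'rV[R]_n),
      harmonic p -> msize p = d.+1 -> zero_set p x ->
      ((forall a : 'X_{1..n}, (mdeg a <= k)%N -> (p^`M[a]).@[x 0] = 0) <->
       (forall r : R, 0 < r -> delta <= Theta k (zero_set p) x r)) /\
      ((exists a : 'X_{1..n}, (mdeg a <= k)%N /\ (p^`M[a]).@[x 0] <> 0) <->
       (exists r : R, 0 < r /\ Theta k (zero_set p) x r < delta))) /\
    (exists C : R, 1 < C /\
      forall (p : {mpoly R[n]}) (x : 'rV[R]_n),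
        harmonic p -> msize p = d.+1 -> zero_set p x ->
        forall r : R, 0 < r -> Theta k (zero_set p) x r < delta ->
        forall s : R, 0 < s < 1 ->
          Theta k (zero_set p) x (s * r) < C * s `^ (k%:R^-1)).
Proof.
have [e e0 gap] := low_nonzero_of_Theta_lt R d.+1 hn hk.
have k0 : 0 < k%:R^-1 :> R by rewrite invr_gt0 ltr0n.
have sz0 (p : {mpoly R[n]}) : msize p = d.+1 -> p != 0.
  by move=> pd; rewrite -msize_poly_eq0 pd.
exists e; split=> //; split; last first.
  have [C C0 CP] := Theta_le_of_low hn hk (ltnW hkd) e0.
  have Ck : 0 <= C `^ (k%:R^-1) by exact: powR_ge0.
  (* The added 2 makes the constant exceed 1 and the final inequality strict. *)
  exists (C `^ (k%:R^-1) + 2); split; first by lra.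
  move=> p x hp pd px r r0 Tr s /andP[s0 s1].
  have p0 := sz0 p pd.
  have pd' : (msize p <= d.+1)%N by rewrite pd.
  apply: le_lt_trans (CP p x r s hp p0 pd' px r0 s0 (ltW s1) _) _.
    exact: gap.
  rewrite powRM ?(ltW C0) ?(ltW s0) // ltr_pM2r ?powR_gt0 //; lra.
move=> p x hp pd px; have p0 := sz0 p pd.
have pd' : (msize p <= d.+1)%N by rewrite pd.
have part1 : (forall a : 'X_{1..n}, (mdeg a <= k)%N -> (p^`M[a]).@[x 0] = 0) <->
       (forall r : R, 0 < r -> e <= Theta k (zero_set p) x r).
  split=> [D0 r r0|big].
    rewrite leNgt; apply/negP => Tr; have rn0 : r != 0 by rewrite gt_eqF.
    have := gap p x r hp p0 pd' px r0 Tr.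
    rewrite (low_aff_eq0 k p x rn0).2 // nrm0 leNgt mulr_gt0 //.
    by apply: nrm_gt0; rewrite aff_eq0.
  (* If the low part at scale 1 is nonzero, its relative size is a [c] depending on [p] and [x];
     this is allowed, since all that is needed is that Theta tends to 0 at small scales. *)
  apply/(low_aff_eq0 k p x (oner_neq0 R)); apply/eqP/negPn/negP => low0.
  have nf : 0 < nrm (aff (x 0) 1 p) by apply: nrm_gt0; rewrite aff_eq0 ?oner_neq0.
  have nl := nrm_gt0 low0; have c0 := divr_gt0 nl nf.
  have [C C0 CP] := Theta_le_of_low hn hk (ltnW hkd) c0.
  (* Small enough that C s < e^k, whence the bound (C s)^(1/k) is below [e]. *)
  pose s := Num.min 1 (e ^+ k / (2 * C)).
  have ek : 0 < e ^+ k by rewrite exprn_gt0.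
  have s0 : 0 < s by rewrite lt_min ltr01 divr_gt0 // mulr_gt0.
  have [s1 se] : s <= 1 /\ s <= e ^+ k / (2 * C) by rewrite !ge_min !lexx orbT.
  have := CP p x 1 s hp p0 pd' px ltr01 s0 s1.
  rewrite divfK ?gt_eqF // mulr1 => /(_ (lexx _)) Ts.
  have := big s s0; rewrite leNgt => /negP; apply; apply: le_lt_trans Ts _.
  have Cs : C * s < e ^+ k.
    by move: se; rewrite ler_pdivlMr ?mulr_gt0 //; lra.
  have kn0 : k%:R != 0 :> R by rewrite pnatr_eq0 -lt0n.
  have -> : e = (e ^+ k) `^ (k%:R^-1).
    by rewrite -powR_mulrn ?(ltW e0) // -powRrM mulfV // powRr1 // ltW.
  by apply: gt0_ltr_powR; rewrite ?nnegrE ?mulr_ge0 ?(ltW C0) ?(ltW s0) ?(ltW ek).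
split=> //; split=> [[a [ak pa]]|[r [r0 Tr]]].
  apply: contrapT => h; apply: pa; apply: part1.2 => // r r0.
  by rewrite leNgt; apply/negP => Tr; apply: h; exists r.
apply: contrapT => h.
have : e <= Theta k (zero_set p) x r.
  apply: part1.1 => // a ak; apply/eqP/negPn/negP => /eqP pa.
  by apply: h; exists a.
by rewrite leNgt Tr.
Qed.
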